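(* Let $m \geq 2$. The following are full totally umbilical lightlike submanifolds in a pseudo-sphere (the indicated target): (1) $\mathbb{S}^{m-1}_{s}(1) \times \mathbb{E}^{0,0,1} \rightarrow \mathbb{S}^{m+1}_{s+1}(1)$; $(x,t) \mapsto (t,x,t)$ (totally geodesic); (2) $\mathbb{S}^{m-1}_{s}(r^2) \times \mathbb{E}^{0,0,1} \rightarrow \mathbb{S}^{m+2}_{s+1}(1)$; $(x,t) \mapsto (t,x,\sqrt{1-r^{2}},t)$ ($0<r<1$); (3) $\mathbb{S}^{m-1}_{s}(r^2) \times \mathbb{E}^{0,0,1} \rightarrow \mathbb{S}^{m+2}_{s+2}(1)$; $(x,t) \mapsto (t,\sqrt{r^{2}-1},x,t)$ ($r>1$); (4) $\mathbb{H}^{m-1}_{s}(-r^2) \times \mathbb{E}^{0,0,1} \rightarrow \mathbb{S}^{m+2}_{s+2}(1)$; $(x,t) \mapsto (t,x,\sqrt{1+r^{2}},t)$ ($r>0$); (5) $\Lambda^{m}_{s} \rightarrow \mathbb{S}^{m+1}_{s+1}(1)$; $x \mapsto (x,1)$; (6) $\Lambda^{m-1}_{s} \times \mathbb{E}^{0,0,1} \rightarrow \mathbb{S}^{m+2}_{s+2}(1)$; $(x,t) \mapsto (t,x,1,t)$; (7) $\mathbb{S}^{m-1}_{s}(1) \times \mathbb{E}^{0,0,1} \rightarrow \mathbb{S}^{m+3}_{s+2}(1)$; $(x,t) \mapsto (t,1,x,1,t)$. Here (6) is $2$-lightlike, and the others are $1$-lightlike.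
   Context: $\mathbb{E}^{n}_{p}$ is $\mathbb{R}^n$ with the metric $\langle\cdot,\cdot\rangle_p=-\sum_{i=1}^{p}dx_i^2+\sum_{j=p+1}^{n}dx_j^2$ (the first $p$ coordinates are the negative ones), and $\mathbb{E}^{0,0,1}$ is $\mathbb{R}$ with the zero (degenerate) metric. For $r>0$, $$\mathbb{S}^{n}_{p}(r^2)=\{x\in\mathbb{E}^{n+1}_{p}\mid\langle x,x\rangle_p=r^2\},\quad \mathbb{H}^{n}_{p}(-r^2)=\{x\in\mathbb{E}^{n+1}_{p+1}\mid\langle x,x\rangle_{p+1}=-r^2\},$$ with the induced metrics, and the lightcone of dimension $n$ and index $p$ is $$\Lambda^{n}_{p}=\{x\in\mathbb{E}^{n+1}_{p+1}\setminus\{0\}\mid\langle x,x\rangle_{p+1}=0\},$$ with the induced (degenerate) metric. An immersion $\phi:M\to\bar M$ into a pseudo-Riemannian manifold $(\bar M,\bar g)$ is $r$-lightlike if the induced metric $g=\phi^*\bar g$ is degenerate and its radical distribution $\mathrm{Rad}\,TM=\{X\in TM\mid g(X,Y)=0\text{ for all }Y\in TM\}$ has constant rank $r>0$; then $\phi(M)$ is called an ($r$-)lightlike submanifold. One chooses a transversal vector bundle $\mathrm{tr}(TM)$, i.e. a vector bundle over $M$ with (not necessarily orthogonal) direct sum decomposition $\phi^*T\bar M=TM\oplus\mathrm{tr}(TM)$, and writes $\bar\nabla_XY=\check\nabla_XY+B(X,Y)$ for $X,Y\in\Gamma(TM)$, where $\bar\nabla$ is the Levi-Civita connection of $\bar M$,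 $\check\nabla_XY$ is the $TM$-component and $B(X,Y)$ is the $\mathrm{tr}(TM)$-component. The lightlike immersion is totally geodesic if $B=0$, and totally umbilical if there is a section $\mathcal{H}$ of $\mathrm{tr}(TM)$ with $B(X,Y)=g(X,Y)\mathcal{H}$ for all $X,Y\in\Gamma(TM)$; these notions do not depend on the choice of $\mathrm{tr}(TM)$. Full means that the image is not contained in any non-degenerate totally geodesic hypersurface of the target. *)

(* Defs.v *)
From mathcomp Require Import all_boot all_order all_algebra.
From mathcomp Require Import all_classical all_reals all_analysis.

Set Implicit Arguments.
Unset Strict Implicit.
Unset Printing Implicit Defensive.

Import Order.TTheory GRing.Theory Num.Theory.
Import numFieldNormedType.Exports.

Local Open Scope classical_set_scope.
Local Open Scope ring_scope.

(* All manifolds are embedded submanifolds of some R^n = 'rV[R]_n, given as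
   subsets.  A smooth function, field or frame on such a submanifold is handled
   through its local smooth extensions to open subsets of R^n; every object
   built from them below is only evaluated at points of the submanifold, in
   tangent directions, where it does not depend on the extension. *)

Fixpoint differentiable_upto (R : realType) (V U : normedModType R) (k : nat)
    (W : set V) (f : V -> U) : Prop :=
  if k is k'.+1 then
    (forall x, W x -> differentiable f x) /\
    (forall v, differentiable_upto k' W (fun x => 'D_v f x))
  else True.

(* f is C^oo on W, where W is meant to be open *)
Definition smooth_on (R : realType) (V U : normedModType R)
    (W : set V) (f : V -> U) : Prop :=
  forall k, differentiable_upto k W f.

Definition smooth_along (R : realType) (V U : normedModType R)
    (M : set V) (f : V -> U) : Prop :=
  forall p, M p -> exists (W : set V) (F : V -> U),
    [/\ open W, W p, smooth_on W F & forall q, W q -> M q -> f q = F q].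

Definition submanifold (R : realType) (n d : nat) (M : set 'rV[R]_n) : Prop :=
  forall p, M p -> exists (k : nat) (W : set 'rV[R]_n) (F : 'rV[R]_n -> 'rV[R]_k),
    [/\ (k + d)%N = n, open W, W p, smooth_on W F &
        forall q, W q ->
          (M q <-> F q = 0) /\
          (M q -> forall w : 'rV[R]_k, exists v, 'd F q v = w)].

(* v is the velocity at 0 of a curve in M through p.  For a submanifold,
   differentiability of the curve at 0 gives the same vectors as smoothness. *)
Definition tangent (R : realType) (n : nat) (M : set 'rV[R]_n)
    (p v : 'rV[R]_n) : Prop :=
  exists c : R -> 'rV[R]_n,
    [/\ c 0 = p, (\forall t \near (0 : R), M (c t)) & is_derive (0 : R) 1 c v].

(* smooth vector field on the open subset of M cut out by W *)
Definition vfield (R : realType) (n : nat) (M W : set 'rV[R]_n)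
    (X : 'rV[R]_n -> 'rV[R]_n) : Prop :=
  [/\ open W, smooth_on W X & forall q, W q -> M q -> tangent M q (X q)].

(* <u, v>_p on E^n_p *)
Definition scal (R : realType) (n p : nat) (u v : 'rV[R]_n) : R :=
  \sum_(i < n) (if (i < p)%N then -1 else 1) * (u 0 i * v 0 i).
Arguments scal {R n} p u v.

(* The dimension n of the ambient space is a parameter of the next three
   definitions, so that the submanifolds have dimension n - 1:
   S^(n-1)_p(c), H^(n-1)_p(c) (with c < 0) and Lambda^(n-1)_p. *)
Definition psphere (R : realType) (n p : nat) (c : R) : set 'rV[R]_n :=
  [set x | scal p x x = c].
Arguments psphere {R} n p c _.

Definition phyperbolic (R : realType) (n p : nat) (c : R) : set 'rV[R]_n :=
  [set x | scal p.+1 x x = c].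
Arguments phyperbolic {R} n p c _.

Definition lightcone (R : realType) (n p : nat) : set 'rV[R]_n :=
  [set x | x <> 0 /\ scal p.+1 x x = 0].
Arguments lightcone R n p _ : clear implicits.

(* A x E^{0,0,1}, with coordinates (x, t), and its product metric when A has
   the metric induced by <.,.>_p *)
Definition times_line (R : realType) (n : nat) (A : set 'rV[R]_n) :
    set 'rV[R]_(n + 1) := [set u | A (lsubmx u)].

Definition scal_line (R : realType) (n p : nat) (u v : 'rV[R]_(n + 1)) : R :=
  scal p (lsubmx u) (lsubmx v) + 0 * (rsubmx u 0 0 * rsubmx v 0 0).
Arguments scal_line {R n} p u v.

Definition in_xt (R : realType) (n N : nat)
    (f : 'rV[R]_n -> 'rV[R]_1 -> 'rV[R]_N) (u : 'rV[R]_(n + 1)) : 'rV[R]_N :=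
  f (lsubmx u) (rsubmx u).

Definition cst1 (R : realType) (c : R) : 'rV[R]_1 := const_mx c.

(* nabla is the Levi-Civita connection of S with the (non-degenerate) metric
   induced by <.,.>_q, acting on locally defined fields *)
Record levi_civita (R : realType) (n q : nat) (S : set 'rV[R]_n)
    (nabla : ('rV[R]_n -> 'rV[R]_n) -> ('rV[R]_n -> 'rV[R]_n) ->
             'rV[R]_n -> 'rV[R]_n) : Prop := LeviCivita {
  lc_vfield : forall W X Y, vfield S W X -> vfield S W Y ->
    smooth_along (S `&` W) (nabla X Y) /\
    (forall x, W x -> S x -> tangent S x (nabla X Y x));
  lc_addl : forall W X X' Y, vfield S W X -> vfield S W X' -> vfield S W Y ->
    forall x, W x -> S x ->
    nabla (fun z => X z + X' z) Y x = nabla X Y x + nabla X' Y x;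
  lc_addr : forall W X Y Y', vfield S W X -> vfield S W Y -> vfield S W Y' ->
    forall x, W x -> S x ->
    nabla X (fun z => Y z + Y' z) x = nabla X Y x + nabla X Y' x;
  lc_linear : forall W (f : 'rV[R]_n -> R) X Y,
    smooth_on W f -> vfield S W X -> vfield S W Y ->
    forall x, W x -> S x ->
    nabla (fun z => f z *: X z) Y x = f x *: nabla X Y x;
  lc_leibniz : forall W (f : 'rV[R]_n -> R) X Y,
    smooth_on W f -> vfield S W X -> vfield S W Y ->
    forall x, W x -> S x ->
    nabla X (fun z => f z *: Y z) x =
      'D_(X x) f x *: Y x + f x *: nabla X Y x;
  lc_torsion : forall W X Y, vfield S W X -> vfield S W Y ->
    forall x, W x -> S x ->
    nabla X Y x - nabla Y X x = 'D_(X x) Y x - 'D_(Y x) X x;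
  lc_metric : forall W X Y Z, vfield S W X -> vfield S W Y -> vfield S W Z ->
    forall x, W x -> S x ->
    'D_(X x) (fun z => scal q (Y z) (Z z)) x =
      scal q (nabla X Y x) (Z x) + scal q (Y x) (nabla X Z x) }.

Definition induced_metric (R : realType) (n N q : nat)
    (phi : 'rV[R]_n -> 'rV[R]_N) (p v w : 'rV[R]_n) : R :=
  scal q ('d phi p v) ('d phi p w).

(* phi is an immersion of the d-dimensional manifold M into S, isometric for
   the given (constant coefficient) metric h on M *)
Record isometric_immersion (R : realType) (n N d q : nat) (M : set 'rV[R]_n)
    (h : 'rV[R]_n -> 'rV[R]_n -> R) (S : set 'rV[R]_N)
    (phi : 'rV[R]_n -> 'rV[R]_N) : Prop := IsometricImmersion {
  imm_source : submanifold d M;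
  imm_smooth : exists2 W, open W & M `<=` W /\ smooth_on W phi;
  imm_target : forall p, M p -> S (phi p);
  imm_inj : forall p v, M p -> tangent M p v -> 'd phi p v = 0 -> v = 0;
  imm_isom : forall p v w, M p -> tangent M p v -> tangent M p w ->
    induced_metric q phi p v w = h v w }.

Definition radical (R : realType) (n N q : nat) (M : set 'rV[R]_n)
    (phi : 'rV[R]_n -> 'rV[R]_N) (p : 'rV[R]_n) : set 'rV[R]_n :=
  [set v | tangent M p v /\
           forall w, tangent M p w -> induced_metric q phi p v w = 0].

Definition lightlike (R : realType) (n N q r : nat) (M : set 'rV[R]_n)
    (phi : 'rV[R]_n -> 'rV[R]_N) : Prop :=
  (0 < r)%N /\
  forall p, M p -> exists2 E : 'M[R]_(r, n), row_free E &
    forall v, radical q M phi p v <-> (v <= E)%MS.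

(* tr p is the fibre over p of a smooth vector bundle on M that is
   complementary to TM in phi^*TS *)
Record transversal_bundle (R : realType) (n N : nat) (M : set 'rV[R]_n)
    (S : set 'rV[R]_N) (phi : 'rV[R]_n -> 'rV[R]_N)
    (tr : 'rV[R]_n -> set 'rV[R]_N) : Prop := TransversalBundle {
  tb_frame : forall p, M p ->
    exists (k : nat) (W : set 'rV[R]_n) (E : 'rV[R]_n -> 'M[R]_(k, N)),
      [/\ open W, W p, smooth_on W E &
          forall x, W x -> M x ->
            row_free (E x) /\ tr x = [set b | (b <= E x)%MS]];
  tb_sub : forall p b, M p -> tr p b -> tangent S (phi p) b;
  tb_sum : forall p w, M p -> tangent S (phi p) w ->
    exists v b, [/\ tangent M p v, tr p b & w = 'd phi p v + b];
  tb_direct : forall p v, M p -> tangent M p v -> tr p ('d phi p v) ->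
    'd phi p v = 0 }.

(* Xb is a local vector field on S around phi p that is phi-related to X *)
Definition extends_field (R : realType) (n N : nat) (M : set 'rV[R]_n)
    (S : set 'rV[R]_N) (phi : 'rV[R]_n -> 'rV[R]_N)
    (p : 'rV[R]_n) (X : 'rV[R]_n -> 'rV[R]_n)
    (Xb : 'rV[R]_N -> 'rV[R]_N) : Prop :=
  (exists2 W, W (phi p) & vfield S W Xb) /\
  (\forall x \near p, M x -> Xb (phi x) = 'd phi x (X x)).

(* bar-nabla_X Y at p, for fields X, Y on M near p; its value does not depend
   on the extensions Xb, Yb *)
Definition nabla_bar (R : realType) (n N : nat) (M : set 'rV[R]_n)
    (S : set 'rV[R]_N) (phi : 'rV[R]_n -> 'rV[R]_N)
    (nabla : ('rV[R]_N -> 'rV[R]_N) -> ('rV[R]_N -> 'rV[R]_N) ->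
             'rV[R]_N -> 'rV[R]_N)
    (X Y : 'rV[R]_n -> 'rV[R]_n) (p : 'rV[R]_n) : 'rV[R]_N :=
  xget 0 [set w | exists Xb Yb, [/\ extends_field M S phi p X Xb,
    extends_field M S phi p Y Yb & w = nabla Xb Yb (phi p)]].

Definition transversal_part (R : realType) (n N : nat) (M : set 'rV[R]_n)
    (phi : 'rV[R]_n -> 'rV[R]_N) (tr : 'rV[R]_n -> set 'rV[R]_N)
    (p : 'rV[R]_n) (w : 'rV[R]_N) : 'rV[R]_N :=
  xget 0 [set b | tr p b /\ exists2 v, tangent M p v & w = 'd phi p v + b].

Definition second_form (R : realType) (n N : nat) (M : set 'rV[R]_n)
    (S : set 'rV[R]_N) (phi : 'rV[R]_n -> 'rV[R]_N)
    (nabla : ('rV[R]_N -> 'rV[R]_N) -> ('rV[R]_N -> 'rV[R]_N) ->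
             'rV[R]_N -> 'rV[R]_N)
    (tr : 'rV[R]_n -> set 'rV[R]_N)
    (X Y : 'rV[R]_n -> 'rV[R]_n) (p : 'rV[R]_n) : 'rV[R]_N :=
  transversal_part M phi tr p (nabla_bar M S phi nabla X Y p).

(* The choice of the transversal bundle is irrelevant in the next two
   definitions; a bundle is required to exist, and the condition to hold for
   every one.  Every global field on M is, near each point, a local one. *)
Definition totally_geodesic (R : realType) (n N : nat) (M : set 'rV[R]_n)
    (S : set 'rV[R]_N) (phi : 'rV[R]_n -> 'rV[R]_N)
    (nabla : ('rV[R]_N -> 'rV[R]_N) -> ('rV[R]_N -> 'rV[R]_N) ->
             'rV[R]_N -> 'rV[R]_N) : Prop :=
  (exists tr, transversal_bundle M S phi tr) /\
  forall tr, transversal_bundle M S phi tr ->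
    forall W X Y, vfield M W X -> vfield M W Y ->
    forall p, W p -> M p -> second_form M S phi nabla tr X Y p = 0.

Definition totally_umbilical (R : realType) (n N q : nat) (M : set 'rV[R]_n)
    (S : set 'rV[R]_N) (phi : 'rV[R]_n -> 'rV[R]_N)
    (nabla : ('rV[R]_N -> 'rV[R]_N) -> ('rV[R]_N -> 'rV[R]_N) ->
             'rV[R]_N -> 'rV[R]_N) : Prop :=
  (exists tr, transversal_bundle M S phi tr) /\
  forall tr, transversal_bundle M S phi tr ->
    exists H : 'rV[R]_n -> 'rV[R]_N,
      [/\ smooth_along M H, forall p, M p -> tr p (H p) &
          forall W X Y, vfield M W X -> vfield M W Y ->
          forall p, W p -> M p ->
            second_form M S phi nabla tr X Y p =
              induced_metric q phi p (X p) (Y p) *: H p].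

Definition hypersurface (R : realType) (N : nat) (S P : set 'rV[R]_N) : Prop :=
  P `<=` S /\
  forall x, P x -> exists (W : set 'rV[R]_N) (f : 'rV[R]_N -> R),
    [/\ open W, W x, smooth_on W f,
        (forall y, W y -> S y -> (P y <-> f y = 0)) &
        exists2 v, tangent S x v & 'd f x v <> 0].

Definition nondegenerate (R : realType) (N q : nat) (P : set 'rV[R]_N) : Prop :=
  forall x v, P x -> tangent P x v ->
    (forall w, tangent P x w -> scal q v w = 0) -> v = 0.

(* For a non-degenerate P: the normal component of nabla_X Y vanishes, for
   fields X, Y on P extended to S. *)
Definition totally_geodesic_subset (R : realType) (N : nat) (S P : set 'rV[R]_N)
    (nabla : ('rV[R]_N -> 'rV[R]_N) -> ('rV[R]_N -> 'rV[R]_N) ->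
             'rV[R]_N -> 'rV[R]_N) : Prop :=
  forall W X Y, vfield S W X -> vfield S W Y -> vfield P W X -> vfield P W Y ->
  forall x, W x -> P x -> tangent P x (nabla X Y x).

Definition full (R : realType) (n N q : nat) (M : set 'rV[R]_n)
    (S : set 'rV[R]_N) (phi : 'rV[R]_n -> 'rV[R]_N)
    (nabla : ('rV[R]_N -> 'rV[R]_N) -> ('rV[R]_N -> 'rV[R]_N) ->
             'rV[R]_N -> 'rV[R]_N) : Prop :=
  forall P, hypersurface S P -> nondegenerate q P ->
    totally_geodesic_subset S P nabla -> ~ (phi @` M `<=` P).

Definition full_umbilical_lightlike (R : realType) (n N r d q : nat)
    (M : set 'rV[R]_n) (h : 'rV[R]_n -> 'rV[R]_n -> R)
    (S : set 'rV[R]_N) (phi : 'rV[R]_n -> 'rV[R]_N) : Prop :=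
  [/\ isometric_immersion d q M h S phi, lightlike q r M phi &
      forall nabla, levi_civita q S nabla ->
        totally_umbilical q M S phi nabla /\ full q M S phi nabla].

(* Main.v *)
(* Each map is the restriction of an affine map u |-> uA + w to a quadric
   h u u = c, where h is the pullback of the ambient metric by A, w is orthogonal
   to the range of A and c + <w, w> = 1.  The Levi-Civita connection of the
   pseudo-sphere being D_X Y + <X, Y> x, the vector bar-nabla_X Y is
   h X Y w modulo the range of A, so B(X, Y) = h X Y H, where H(u) is the element
   of tr(TM) congruent to w modulo the range of A; in case (1), w = 0 and H = 0.
   Let P be a non-degenerate totally geodesic hypersurface containing the image.
   Its normal nu at one point is orthogonal to the tangent vectors of M and to
   bar-nabla_X Y, hence to the range of A and to w; but all such vectors are null,
   which contradicts non-degeneracy. *)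
Require Import Defs.
From HB Require Import structures.
From mathcomp Require Import all_boot all_order all_algebra.
From mathcomp Require Import all_classical all_reals all_analysis.
From mathcomp Require Import zify ring lra.
Import Order.TTheory GRing.Theory Num.Theory.
Import numFieldNormedType.Exports.
Local Open Scope classical_set_scope.
Local Open Scope ring_scope.

Set Implicit Arguments.
Unset Strict Implicit.
Unset Printing Implicit Defensive.

(** * Smooth maps *)

Section SmoothCalculus.
Variable R : realType.
Implicit Types V U : normedModType R.

(** A tangent vector is the velocity of a curve differentiable at one parameter, so each description
    of a tangent space by equations requires explicit curves. On quadrics they are rational; on a
    hypersurface [P] of the sphere the intermediate value theorem gives one, with no regularity away
    from 0. When [c = 0] the position vector [p] is itself tangent to [M], so it cannot serve as a
    transverse direction. Its substitute is [gunit p], with [h p (gunit p) = 1], along which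
    vectors, fields and frames are corrected to become tangent. It exists outside the radical of
    [h]; being outside is automatic on [h u u = c] if [c <> 0], and for [c = 0] it is what removing
    the origin from the cone means. The tangent space of [M] gives only a hyperplane of the range of
    [A]. The missing direction and [w] come from a 2 x 2 linear system, expressing that [nu] is
    orthogonal to [phi p] and to bar-nabla_X Y. Its determinant is [h X Y], so tangent vectors with
    [h X Y <> 0] are required. *)

Lemma derive_congr V U (W : set V) (f g : V -> U) x v :
  open W -> {in W, f =1 g} -> W x -> 'D_v f x = 'D_v g x.
Proof.
move=> oW fg Wx; apply: near_eq_derive.
by apply: filterS (open_nbhs_nbhs (conj oW Wx)) => y Wy; apply/fg/mem_set.
Qed.

Lemma differentiable_congr V U (W : set V) (f g : V -> U) x :
  open W -> {in W, f =1 g} -> W x -> differentiable f x -> differentiable g x.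
Proof.
move=> oW fg Wx /diff_locallyP [cf ef].
have nW : \forall y \near x, W y by exact: open_nbhs_nbhs.
have fgx : f x = g x by apply/fg/mem_set.
have eg : g \o shift x = cst (g x) + 'd f x +o_ (0 : V) id.
  apply/eqaddoP => e e0.
  have /eqaddoP/(_ e e0) H := ef.
  have nW0 : \forall y \near (0 : V), W (y + x).
    by move: nW; rewrite (near_shift 0 x); apply: filterS => y; rewrite /= subr0.
  near=> y.
  have Hy : `|(f \o shift x - (cst (f x) + 'd f x)) y| <= e * `|y|.
    by near: y; exact: H.
  have Wy : W (y + x) by near: y.
  move: Hy.
  by rewrite !fctE /= fgx (fg (y + x)) ?inE.
have dg := diff_unique cf eg.
by apply/diff_locallyP; rewrite dg.
Unshelve. all: by end_near. Qed.

Lemma upto_congr V U k (W : set V) (f g : V -> U) :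
  open W -> {in W, f =1 g} ->
  differentiable_upto k W f -> differentiable_upto k W g.
Proof.
move=> oW; elim: k f g => //= k IH f g fg [df Df]; split.
  by move=> x Wx; apply: (differentiable_congr oW fg) => //; exact: df.
move=> v; apply: IH (Df v) => x /set_mem Wx; exact: derive_congr fg Wx.
Qed.

Lemma upto_sub V U k (W W' : set V) (f : V -> U) :
  W' `<=` W -> differentiable_upto k W f -> differentiable_upto k W' f.
Proof.
move=> sW; elim: k f => //= k IH f [df Df]; split => [x /sW|v]; first exact: df.
exact: IH.
Qed.

Lemma uptoW V U k (W : set V) (f : V -> U) :
  differentiable_upto k.+1 W f -> differentiable_upto k W f.
Proof.
elim: k f => //= k IH f [df Df]; split => // v; apply: IH; exact: Df.
Qed.

Lemma upto_cst V U k (W : set V) (a : U) : differentiable_upto k W (fun=> a).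
Proof.
elim: k a => //= k IH a; split => [x _|v]; first exact: differentiable_cst.
have -> : (fun x : V => 'D_v (fun=> a) x) = (fun=> 0).
  by apply/funext => x; exact: derive_cst.
exact: IH.
Qed.

Lemma uptoD V U k (W : set V) (f g : V -> U) : open W ->
  differentiable_upto k W f -> differentiable_upto k W g ->
  differentiable_upto k W (fun x => f x + g x).
Proof.
move=> oW; elim: k f g => //= k IH f g [df Df] [dg Dg]; split => [x Wx|v].
  by apply: differentiableD; [exact: df|exact: dg].
apply: (upto_congr oW _ (IH _ _ (Df v) (Dg v))) => x /set_mem Wx.
by rewrite -deriveD //; apply: diff_derivable; [exact: df|exact: dg].
Qed.

Lemma upto_lin V U U' k (W : set V) (f : V -> U) (L : {linear U -> U'}) :
  open W -> continuous L ->
  differentiable_upto k W f -> differentiable_upto k W (L \o f).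
Proof.
move=> oW cL; elim: k f => //= k IH f [df Df].
have dL y : differentiable L y by exact: linear_differentiable.
have dLf x : W x -> differentiable (L \o f) x.
  by move=> Wx; apply: differentiable_comp => //; exact: df.
split => // v; apply: (upto_congr oW _ (IH _ (Df v))) => x /set_mem Wx.
have dfx := df _ Wx; have dLfx := dLf _ Wx.
by rewrite (deriveE v dLfx) (diff_comp dfx (dL _)) /= diff_lin // (deriveE v dfx).
Qed.

(** The product rule, read off from the differential of the bilinear map [(a, u) |-> a *: u]
    composed with the pair [(f, g)]. *)
Lemma differentiable_scale V U (f : V -> R) (g : V -> U) x :
  differentiable f x -> differentiable g x ->
  differentiable (fun z => f z *: g z) x /\
  forall v, 'D_v (fun z => f z *: g z) x =
            'D_v f x *: g x + f x *: 'D_v g x.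
Proof.
move=> df dg.
pose B : R -> U -> U := fun a u => a *: u.
have linl u : linear (B^~ u) by move=> a b c; rewrite /B scalerDl scalerA.
have linr a : linear (B a).
  by move=> b c d; rewrite /B scalerDr !scalerA mulrC.
pose bB := bilinear_isBilinear.Build R R U U _ _ B (linl, linr).
pose BB : {bilinear R -> U -> U} := HB.pack B bB.
have cB : continuous (fun p : R * U => BB p.1 p.2).
  by move=> p; exact: scale_continuous.
have dp : differentiable (fun z => (f z, g z)) x by exact: differentiable_pair.
have dB : differentiable (fun p : R * U => BB p.1 p.2) (f x, g x).
  exact: differentiable_bilin.
have dc : differentiable (fun z => f z *: g z) x.
  exact: (differentiable_comp dp dB).
split => // v; rewrite (deriveE v dc) (deriveE v df) (deriveE v dg).
have -> : 'd (fun z => f z *: g z) x =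
    'd (fun p : R * U => BB p.1 p.2) (f x, g x) \o 'd (fun z => (f z, g z)) x :> (V -> U).
  exact: (diff_comp dp dB).
by rewrite /= (diff_bilin _ cB) (diff_pair df dg) /= addrC.
Qed.

Lemma upto_scale V U k (W : set V) (f : V -> R) (g : V -> U) : open W ->
  differentiable_upto k W f -> differentiable_upto k W g ->
  differentiable_upto k W (fun x => f x *: g x).
Proof.
move=> oW; elim: k f g => //= k IH f g [df Df] [dg Dg].
split => [x Wx|v].
  by have [] := differentiable_scale (df x Wx) (dg x Wx).
have dfk : differentiable_upto k W f by exact: uptoW.
have dgk : differentiable_upto k W g by exact: uptoW.
apply: (upto_congr oW _ (uptoD oW (IH _ _ (Df v) dgk) (IH _ _ dfk (Dg v)))).
move=> x /set_mem Wx.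
by have [_ ->] := differentiable_scale (df x Wx) (dg x Wx).
Qed.

(** The induction closes because the derivative of [1 / f] is [- (1 / f) (1 / f) f'], a product of
    functions already known to be differentiable up to order [k]. *)
Lemma upto_inv V k (W : set V) (f : V -> R) : open W ->
  (forall x, W x -> f x != 0) ->
  differentiable_upto k W f -> differentiable_upto k W (fun x => (f x)^-1).
Proof.
move=> oW f0; elim: k => //= k IH [df Df]; split => [x Wx|v].
  by apply: differentiableV; [exact: df|exact: f0].
have IHk : differentiable_upto k W (fun x => (f x)^-1).
  by apply: IH; exact: uptoW.
have H := upto_scale oW (upto_scale oW (upto_cst k W (-1 : R)) IHk)
  (upto_scale oW IHk (Df v)).
apply: (upto_congr oW _ H) => x /set_mem Wx.
rewrite deriveV ?f0 //; last by apply: diff_derivable; exact: df.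
by rewrite !scalerA -[LHS]/(_ * _) -[RHS]/(_ * _) expr2 invfM -[-1 *: _]/(-1 * _) mulN1r !mulNr.
Qed.

(** For an affine inner map the derivative along [v] is the derivative of [f] along [L v] after the
    same substitution, so the induction on [k] produces no new terms. *)
Lemma upto_precomp V V' U k (W : set V') (L : {linear V -> V'}) (d : V')
    (f : V' -> U) : open W -> continuous L ->
  differentiable_upto k W f ->
  differentiable_upto k [set y | W (L y + d)] (fun y => f (L y + d)).
Proof.
move=> oW cL.
have dL y : differentiable (fun y => L y + d) y.
  by apply: differentiableD; [exact: linear_differentiable|exact: differentiable_cst].
have cLd : continuous (fun y => L y + d).
  by move=> y; exact: (differentiable_continuous (dL y)).
have oW' : open [set y | W (L y + d)] by exact: (open_comp (fun y _ => cLd y) oW).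
elim: k f => //= k IH f [df Df].
have dfL y : W (L y + d) -> differentiable (fun y => f (L y + d)) y.
  move=> Wy; apply: (differentiable_comp (f := fun y => L y + d)) => //.
  exact: df.
split => // v.
apply: (upto_congr oW' _ (IH _ (Df (L v)))) => y /set_mem Wy.
have dfy := df _ Wy.
rewrite (deriveE _ dfy) (deriveE _ (dfL _ Wy)).
have -> : 'd (fun y => f (L y + d)) y =
    'd f (L y + d) \o 'd (fun y => L y + d) y :> (V -> U).
  exact: (diff_comp (dL y) dfy).
have -> : 'd (fun y => L y + d) y = 'd L y \+ 'd (cst d) y :> (V -> V').
  by apply: (diffD (linear_differentiable y cL)); exact: differentiable_cst.
by rewrite diff_cst diff_lin //= addr0.
Qed.

End SmoothCalculus.

(** * Smooth matrix-valued maps and derivatives along curves *)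

Section SmoothMatrices.
Variable R : realType.
Implicit Types V U : normedModType R.

Lemma linear_mx_continuous m n U (L : {linear 'M[R]_(m, n) -> U}) :
  continuous L.
Proof.
move=> M; apply: differentiable_continuous.
have -> : (L : 'M[R]_(m, n) -> U) =
    \sum_i (\sum_j (fun N : 'M[R]_(m, n) => N i j *: L (delta_mx i j))).
  apply/funext => N; rewrite {1}(matrix_sum_delta N) linear_sum fct_sumE.
  apply: eq_bigr => i _; rewrite linear_sum fct_sumE.
  by apply: eq_bigr => j _; rewrite linearZ.
apply: differentiable_sum => i; apply: differentiable_sum => j.
apply: (differentiableZl (k := fun N : 'M[R]_(m, n) => N i j)).
exact: differentiable_coord.
Qed.

Lemma linear_mx_differentiable m n U (L : {linear 'M[R]_(m, n) -> U}) M :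
  differentiable L M.
Proof. by apply: linear_differentiable; exact: linear_mx_continuous. Qed.

Lemma smooth_differentiable V U (W : set V) (f : V -> U) x :
  smooth_on W f -> W x -> differentiable f x.
Proof. by move=> sf; have [] := sf 1%N => + _; apply. Qed.

Lemma smooth_derive V U (W : set V) (f : V -> U) v :
  smooth_on W f -> smooth_on W ('D_v f).
Proof. by move=> sf k; have [_] := sf k.+1; apply. Qed.

Lemma smooth_congr V U (W : set V) (f g : V -> U) :
  open W -> {in W, f =1 g} -> smooth_on W f -> smooth_on W g.
Proof. by move=> oW fg sf k; exact: upto_congr fg (sf k). Qed.

Lemma smooth_sub V U (W W' : set V) (f : V -> U) :
  W' `<=` W -> smooth_on W f -> smooth_on W' f.
Proof. by move=> sW sf k; exact: upto_sub (sf k). Qed.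

Lemma smooth_cst V U (W : set V) (a : U) : smooth_on W (fun=> a).
Proof. by move=> k; exact: upto_cst. Qed.

Lemma smoothD V U (W : set V) (f g : V -> U) : open W ->
  smooth_on W f -> smooth_on W g -> smooth_on W (fun x => f x + g x).
Proof. by move=> oW sf sg k; exact: uptoD. Qed.

Lemma smooth_scale V U (W : set V) (f : V -> R) (g : V -> U) : open W ->
  smooth_on W f -> smooth_on W g -> smooth_on W (fun x => f x *: g x).
Proof. by move=> oW sf sg k; exact: upto_scale. Qed.

Lemma smoothM V (W : set V) (f g : V -> R) : open W ->
  smooth_on W f -> smooth_on W g -> smooth_on W (fun x => f x * g x).
Proof. exact: smooth_scale. Qed.

Lemma smoothN V U (W : set V) (f : V -> U) : open W ->
  smooth_on W f -> smooth_on W (fun x => - f x).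
Proof.
move=> oW sf.
rewrite (_ : (fun x => - f x) = (fun x => -1 *: f x)); last first.
  by apply/funext => x; rewrite scaleN1r.
by apply: smooth_scale => //; exact: smooth_cst.
Qed.

Lemma smoothV V (W : set V) (f : V -> R) : open W ->
  (forall x, W x -> f x != 0) -> smooth_on W f ->
  smooth_on W (fun x => (f x)^-1).
Proof. by move=> oW f0 sf k; exact: upto_inv. Qed.

Lemma smooth_lin V U U' (W : set V) (f : V -> U) (L : {linear U -> U'}) :
  open W -> continuous L -> smooth_on W f -> smooth_on W (L \o f).
Proof. by move=> oW cL sf k; exact: upto_lin. Qed.

Lemma smooth_precomp V V' U (W : set V') (L : {linear V -> V'}) (d : V')
    (f : V' -> U) : open W -> continuous L -> smooth_on W f ->
  smooth_on [set y | W (L y + d)] (fun y => f (L y + d)).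
Proof. by move=> oW cL sf k; exact: upto_precomp. Qed.

Lemma smooth_sum V U (W : set V) (I : Type) (r : seq I) (P : pred I)
    (F : I -> V -> U) :
  open W -> (forall i, smooth_on W (F i)) ->
  smooth_on W (fun x => \sum_(i <- r | P i) F i x).
Proof.
move=> oW sF; elim: r => [|i r IH].
  by under eq_fun do rewrite big_nil; exact: smooth_cst.
under eq_fun do rewrite big_cons.
by case: (P i) => //; exact: smoothD.
Qed.

Lemma smooth_prod V (W : set V) (I : Type) (r : seq I) (P : pred I)
    (F : I -> V -> R) :
  open W -> (forall i, smooth_on W (F i)) ->
  smooth_on W (fun x => \prod_(i <- r | P i) F i x).
Proof.
move=> oW sF; elim: r => [|i r IH].
  by under eq_fun do rewrite big_nil; exact: smooth_cst.
under eq_fun do rewrite big_cons.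
by case: (P i) => //; exact: smoothM.
Qed.

Lemma smooth_id V (W : set V) : smooth_on W (@id V).
Proof.
case=> //= k; split => [x _|v]; first exact: ex_diff.
by under eq_fun do rewrite derive_id; exact: upto_cst.
Qed.

Lemma smooth_coord V m n (W : set V) (F : V -> 'M[R]_(m, n)) i j : open W ->
  smooth_on W F -> smooth_on W (fun x => F x i j).
Proof.
move=> oW sF.
have linc : linear (fun M : 'M[R]_(m, n) => M i j).
  by move=> a A B; rewrite !mxE.
pose L : {linear 'M[R]_(m, n) -> R} :=
  HB.pack (fun M : 'M[R]_(m, n) => M i j) (GRing.isLinear.Build _ _ _ _ _ linc).
by apply: (smooth_lin (L := L)) => //; exact: linear_mx_continuous.
Qed.

Lemma smooth_mx V m n (W : set V) (F : V -> 'M[R]_(m, n)) : open W ->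
  (forall i j, smooth_on W (fun x => F x i j)) -> smooth_on W F.
Proof.
move=> oW sF.
rewrite (_ : F = (fun x => \sum_i \sum_j F x i j *: delta_mx i j)); last first.
  by apply/funext => x; exact: matrix_sum_delta.
apply: smooth_sum => // i; apply: smooth_sum => // j.
by apply: smooth_scale => //; exact: smooth_cst.
Qed.

Lemma smooth_mulmx V m n p (W : set V) (F : V -> 'M[R]_(m, n))
    (G : V -> 'M[R]_(n, p)) : open W ->
  smooth_on W F -> smooth_on W G -> smooth_on W (fun x => F x *m G x).
Proof.
move=> oW sF sG; apply: smooth_mx => // i j.
under eq_fun do rewrite mxE.
by apply: smooth_sum => // k; apply: smoothM => //; exact: smooth_coord.
Qed.

Lemma smooth_trmx V m n (W : set V) (F : V -> 'M[R]_(m, n)) : open W ->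
  smooth_on W F -> smooth_on W (fun x => (F x)^T).
Proof.
move=> oW sF; apply: smooth_mx => // i j.
by under eq_fun do rewrite mxE; exact: smooth_coord.
Qed.

Lemma smooth_det V n (W : set V) (F : V -> 'M[R]_n) : open W ->
  smooth_on W F -> smooth_on W (fun x => \det (F x)).
Proof.
move=> oW sF; apply: smooth_sum => // s; apply: smoothM => //.
  exact: smooth_cst.
by apply: smooth_prod => // i; exact: smooth_coord.
Qed.

Lemma smooth_invmx V n (W : set V) (F : V -> 'M[R]_n) : open W ->
  (forall x, W x -> F x \in unitmx) -> smooth_on W F ->
  smooth_on W (fun x => invmx (F x)).
Proof.
move=> oW uF sF.
have H : smooth_on W (fun x => (\det (F x))^-1 *: \adj (F x)).
  apply: smooth_scale => //.
    apply: smoothV => //; last exact: smooth_det.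
    by move=> x /uF; rewrite unitmxE unitfE.
  apply: smooth_mx => // i j.
  under eq_fun do rewrite mxE.
  apply: smoothM => //; first exact: smooth_cst.
  apply: smooth_det => //; apply: smooth_mx => // k l.
  by under eq_fun do rewrite !mxE; exact: smooth_coord.
apply: smooth_congr H => // x /set_mem Wx.
by rewrite /invmx uF.
Qed.

Lemma smooth_scal V n q (W : set V) (F G : V -> 'rV[R]_n) : open W ->
  smooth_on W F -> smooth_on W G -> smooth_on W (fun x => scal q (F x) (G x)).
Proof.
move=> oW sF sG; apply: smooth_sum => // i; apply: smoothM => //.
  exact: smooth_cst.
by apply: smoothM => //; exact: smooth_coord.
Qed.

Lemma smooth_open_neq0 V (W : set V) (f : V -> R) :
  open W -> smooth_on W f -> open (W `&` [set x | f x != 0]).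
Proof.
move=> oW sf; rewrite openE => x [Wx fx].
have cf : {for x, continuous f}.
  by apply: differentiable_continuous; exact: smooth_differentiable sf Wx.
apply: filterI; first exact: open_nbhs_nbhs.
exact: (cvgr_neq0 _ cf fx).
Qed.

Lemma is_derive_mxP V m n (F : V -> 'M[R]_(m, n)) x v D :
  is_derive x v F D <-> forall i j, is_derive x v (fun y => F y i j) (D i j).
Proof.
split=> [[dF <-] i j|H].
  split; first exact: (derivable_mxP F x v).1.
  by rewrite derive_mx // mxE.
have dF : derivable F x v by apply/derivable_mxP => i j; have [] := H i j.
split=> //; rewrite derive_mx //; apply/matrixP => i j; rewrite mxE.
by have [] := H i j.
Qed.

Lemma is_derive_scal V n q (F G : V -> 'rV[R]_n) x v DF DG :
  is_derive x v F DF -> is_derive x v G DG ->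
  is_derive x v (fun y => scal q (F y) (G y))
    (scal q DF (G x) + scal q (F x) DG).
Proof.
move=> /is_derive_mxP dF /is_derive_mxP dG.
rewrite (_ : (fun y => _) = \sum_(i < n) (fun y =>
    (if (i < q)%N then -1 else 1) * (F y 0 i * G y 0 i))); last first.
  by apply/funext => y; rewrite fct_sumE.
rewrite -big_split /=; apply: is_derive_sum => i.
have dFi := dF 0 i; have dGi := dG 0 i.
set e := (if _ then _ else _).
have -> : e * (DF 0 i * G x 0 i) + e * (F x 0 i * DG 0 i) =
    e *: (F x 0 i *: DG 0 i + G x 0 i *: DF 0 i).
  by rewrite -mulrDr -[RHS]/(e * (_ * _ + _ * _)) addrC [DF 0 i * _]mulrC.
exact: (@is_deriveZ _ _ _ _ e _ _ _ (is_deriveM dFi dGi)).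
Qed.

Lemma differentiable_is_derive V U (f : V -> U) x v :
  differentiable f x -> is_derive x v f ('d f x v).
Proof.
move=> df; split; first exact: diff_derivable.
exact: deriveE.
Qed.

Lemma is_derive_curve U (f : R -> U) (x : R) (v : U) :
  is_derive x (1 : R) f v -> differentiable f x /\ 'd f x 1 = v.
Proof.
case=> /derivable1_diffP df <-; split => //.
by rewrite deriveE.
Qed.

Lemma is_derive_comp_curve V U (f : V -> U) (c : R -> V) v :
  differentiable f (c 0) -> is_derive (0 : R) (1 : R) c v ->
  is_derive (0 : R) (1 : R) (f \o c) ('d f (c 0) v).
Proof.
move=> df /is_derive_curve [dc <-].
have dfc := differentiable_comp dc df.
have -> : 'd f (c 0) ('d c 0 1) = 'd (f \o c) 0 1 by rewrite (diff_comp dc df).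
exact: differentiable_is_derive.
Qed.

End SmoothMatrices.

(** * Quadrics *)

Section ScalAlgebra.
Variables (R : realType) (n q : nat).
Implicit Types u v w : 'rV[R]_n.

Lemma scalC u v : scal q u v = scal q v u.
Proof. by apply: eq_bigr => i _; rewrite [u 0 i * _]mulrC. Qed.

Lemma scalDl u v w : scal q (u + v) w = scal q u w + scal q v w.
Proof. by rewrite -big_split; apply: eq_bigr => i _ /=; rewrite mxE; ring. Qed.

Lemma scalZl a u v : scal q (a *: u) v = a * scal q u v.
Proof. by rewrite mulr_sumr; apply: eq_bigr => i _; rewrite mxE; ring. Qed.

Lemma scalDr u v w : scal q w (u + v) = scal q w u + scal q w v.
Proof. by rewrite !(scalC w) scalDl. Qed.

Lemma scalZr a u v : scal q u (a *: v) = a * scal q u v.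
Proof. by rewrite !(scalC u) scalZl. Qed.

Lemma scalNl u v : scal q (- u) v = - scal q u v.
Proof. by rewrite -scaleN1r scalZl mulN1r. Qed.

Lemma scalNr u v : scal q u (- v) = - scal q u v.
Proof. by rewrite !(scalC u) scalNl. Qed.

Lemma scal0l v : scal q 0 v = 0.
Proof. by rewrite -(scale0r 0) scalZl mul0r. Qed.

Lemma scal0r v : scal q v 0 = 0.
Proof. by rewrite scalC scal0l. Qed.

Definition scalE := (scalDl, scalDr, scalNl, scalNr, scalZl, scalZr).

Lemma scal_delta u i : scal q u (delta_mx 0 i) = (if (i < q)%N then -1 else 1) * u 0 i.
Proof.
rewrite /scal (bigD1 i) //= mxE !eqxx mulr1 big1 ?addr0 // => j ji.
by rewrite mxE (negPf ji) andbF mulr0 mulr0.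
Qed.

Lemma scal_nondegenerate u : (forall v, scal q u v = 0) -> u = 0.
Proof.
move=> u0; apply/rowP => i; rewrite mxE.
have /eqP := u0 (delta_mx 0 i); rewrite scal_delta mulf_eq0.
by case: ifP => _; rewrite ?oppr_eq0 oner_eq0 => /eqP.
Qed.

Lemma scal_riesz (f : {linear 'rV[R]_n -> R}) :
  exists nu, forall v, scal q nu v = f v.
Proof.
exists (\row_i ((if (i < q)%N then -1 else 1) * f (delta_mx 0 i))) => v.
rewrite {2}(row_sum_delta v) linear_sum; apply: eq_bigr => i _.
by rewrite mxE linearZ /= mulrA mulrA -expr2; case: ifP; rewrite ?sqrrN expr1n mul1r mulrC.
Qed.

End ScalAlgebra.

Definition gram (R : realType) (n N q : nat) (A : 'M[R]_(n, N))
    (u v : 'rV[R]_n) : R := scal q (u *m A) (v *m A).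

Section GramAlgebra.
Variables (R : realType) (n N q : nat) (A : 'M[R]_(n, N)).
Local Notation h := (gram q A).
Implicit Types u v w : 'rV[R]_n.

Lemma gramC u v : h u v = h v u. Proof. exact: scalC. Qed.

Lemma gramDl u v w : h (u + v) w = h u w + h v w.
Proof. by rewrite /gram mulmxDl scalDl. Qed.

Lemma gramDr u v w : h w (u + v) = h w u + h w v.
Proof. by rewrite /gram mulmxDl scalDr. Qed.

Lemma gramZl a u v : h (a *: u) v = a * h u v.
Proof. by rewrite /gram -scalemxAl scalZl. Qed.

Lemma gramZr a u v : h u (a *: v) = a * h u v.
Proof. by rewrite /gram -scalemxAl scalZr. Qed.

Lemma gramNl u v : h (- u) v = - h u v.
Proof. by rewrite /gram mulNmx scalNl. Qed.

Lemma gramNr u v : h u (- v) = - h u v.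
Proof. by rewrite /gram mulNmx scalNr. Qed.

Lemma gram0l v : h 0 v = 0.
Proof. by rewrite /gram mul0mx scal0l. Qed.

Definition gramE := (gramDl, gramDr, gramNl, gramNr, gramZl, gramZr).

End GramAlgebra.

Section Quadric.
Variable R : realType.

Lemma is_derive_scale_curve (U : normedModType R) (f : R -> R) (g : R -> U)
    (x df : R) (dg : U) :
  is_derive x (1 : R) f df -> is_derive x (1 : R) g dg ->
  is_derive x (1 : R) (fun t => f t *: g t) (df *: g x + f x *: dg).
Proof.
move=> Df Dg; have [/derivable1_diffP cf <-] := Df.
have [/derivable1_diffP cg <-] := Dg.
have [dfg Dfg] := differentiable_scale cf cg.
by split; [exact/derivable1_diffP|rewrite Dfg].
Qed.

Lemma is_derive_line (U : normedModType R) (a v : U) (x : R) :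
  is_derive x (1 : R) (fun t => a + t *: v) v.
Proof.
have H := is_deriveD (is_derive_cst a x (1 : R))
  (is_derive_scale_curve (is_derive_id x (1 : R)) (is_derive_cst v x (1 : R))).
by apply: is_derive_eq H _; rewrite scaler0 scale1r add0r addr0.
Qed.

Variables (n N q : nat) (A : 'M[R]_(n, N)) (c : R) (M : set 'rV[R]_n).
Local Notation h := (gram q A).
Hypothesis ME :
  forall u, M u <-> h u u = c /\ exists z, h u z != 0.

(* The curve is the second intersection of M with the line through a fixed
   point b of the quadric and p + t v. *)
Lemma tangent_quadric p v : M p -> tangent M p v <-> h p v = 0.
Proof.
move=> /ME [pc [z hz]]; split.
  case=> cv [c0 nM dc].
  have dcA : is_derive (0 : R) (1 : R) (fun t => cv t *m A) (v *m A).
    have H := is_derive_comp_curve (linear_mx_differentiable (mulmxr A) (cv 0)) dc.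
    apply: is_derive_eq H _.
    by rewrite (diff_lin _ (@linear_mx_continuous _ _ _ _ (mulmxr A))).
  have dsc := is_derive_scal q dcA dcA.
  have nc : \forall t \near (0 : R), scal q (cv t *m A) (cv t *m A) = cst c t.
    by apply: filterS nM => t /ME [].
  have [_ d1] := near_eq_is_derive nc dsc.
  move: d1; rewrite derive_cst c0 scalC -mulr2n -/(h p v) => /esym/eqP.
  by rewrite mulrn_eq0 /= => /eqP.
move=> hv.
(* The chord from [b] to [p] must not be isotropic, and [h (p - b) (p - b) = 2 (c - h b p)]. For
   [c <> 0] the antipode [- p] will do; for [c = 0] a null vector pairing to 1 with [p] is built
   from [z]. *)
have [b [oc op]] : exists b, h b b = c /\ h b p != c.
  have [c0|c0] := eqVneq c 0.
    have [z' hz'] : exists z', h p z' = 1.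
      by exists ((h p z)^-1 *: z); rewrite gramZr mulVf.
    exists (z' - (h z' z' / 2) *: p); split.
      by rewrite !gramE pc c0 [h z' p]gramC hz'; field.
    by rewrite !gramE pc c0 gramC hz' mulr0 subr0 oner_eq0.
  exists (- p); rewrite !gramE opprK pc; split => //.
  by rewrite -subr_eq0 -opprD oppr_eq0 -mulr2n mulrn_eq0.
pose d t := (p - b) + t *: v.
pose dA t := (p - b) *m A + t *: (v *m A).
have dAE t : d t *m A = dA t by rewrite /d mulmxDl -scalemxAl.
pose f t := h b (d t).
pose g t := h (d t) (d t).
have Dd : is_derive (0 : R) (1 : R) d v by exact: is_derive_line.
have DdA : is_derive (0 : R) (1 : R) dA (v *m A) by exact: is_derive_line.
have fE : f = (fun t => scal q (b *m A) (dA t)).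
  by apply/funext => t; rewrite -dAE.
have gE : g = (fun t => scal q (dA t) (dA t)).
  by apply/funext => t; rewrite -dAE.
have Df : is_derive (0 : R) (1 : R) f (h b v).
  rewrite fE; apply: is_derive_eq (is_derive_scal q (is_derive_cst (b *m A) (0 : R) (1 : R)) DdA) _.
  by rewrite scal0l add0r.
have d0 : d 0 = p - b by rewrite /d scale0r addr0.
have f0 : f 0 = h b p - c by rewrite /f d0 !gramE -oc.
have g0 : g 0 = - 2 * f 0.
  by rewrite f0 /g d0 !gramE pc oc [h p b]gramC; ring.
have g0n : g 0 != 0 by rewrite g0 f0 mulf_neq0 ?oppr_eq0 ?subr_eq0 // pnatr_eq0.
have Dg : is_derive (0 : R) (1 : R) g (- 2 * h b v).
  rewrite gE; apply: is_derive_eq (is_derive_scal q DdA DdA) _.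
  rewrite -dAE d0 -/(h v (p - b)) -/(h (p - b) v).
  by rewrite !gramE [h v p]gramC [h v b]gramC hv; ring.
(* The nonzero root of [2 lam h b d + lam^2 h d d = 0], that is, of [h (b + lam d) (b + lam d) = c].
   It equals 1 at [t = 0] and is stationary there because [h p v = 0]; hence the curve has velocity
   [v]. *)
pose lam t := - 2 * f t * (g t)^-1.
have Dlam : is_derive (0 : R) (1 : R) lam 0.
  have Dg1 : is_derive (0 : R) (1 : R) (fun t => (g t)^-1)
      (- (g 0) ^- 2 *: (- 2 * h b v)).
    have [dg <-] := Dg.
    by split; [exact: derivableV|exact: deriveV].
  have H := is_derive_scale_curve (is_deriveZ (- 2 : R) Df) Dg1.
  apply: is_derive_eq H _.
  rewrite -[( _ \*: f) 0]/(- 2 * f 0) -g0 -![_ *: _]/(_ * _).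
  by move: g0n; set gg := g 0 => g0n; field.
have lam0 : lam 0 = 1 by rewrite /lam -g0 divff.
pose cv t := b + lam t *: d t.
have cv0 : cv 0 = p by rewrite /cv lam0 scale1r d0 addrC subrK.
have Dcv : is_derive (0 : R) (1 : R) cv v.
  have H := is_deriveD (is_derive_cst b (0 : R) (1 : R))
    (is_derive_scale_curve Dlam Dd).
  by apply: is_derive_eq H _; rewrite scale0r !add0r lam0 scale1r.
exists cv; split => //.
have cg : {for (0 : R), continuous g}.
  by apply: differentiable_continuous; have [] := is_derive_curve Dg.
have cz : {for (0 : R), continuous (fun t => h (cv t) z)}.
  apply: differentiable_continuous.
  have DcvA : is_derive (0 : R) (1 : R) (fun t => cv t *m A) (v *m A).
    have H := is_derive_comp_curve (linear_mx_differentiable (mulmxr A) (cv 0)) Dcv.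
    apply: is_derive_eq H _.
    by rewrite (diff_lin _ (@linear_mx_continuous _ _ _ _ (mulmxr A))).
  have H := is_derive_scal q DcvA (is_derive_cst (z *m A) (0 : R) (1 : R)).
  by have [] := is_derive_curve H.
near=> t.
apply/ME; split; last first.
  exists z; near: t; apply: (cvgr_neq0 _ cz).
  by rewrite cv0.
have gt0 : g t != 0 by near: t; exact: (cvgr_neq0 _ cg g0n).
have key a y : h (b + a *: y) (b + a *: y) = c + 2 * a * h b y + a ^+ 2 * h y y.
  by rewrite !gramE oc [h y b]gramC; ring.
rewrite key -/(f t) -/(g t) /lam.
by move: gt0; set gg := g t; set ff := f t => gt0; field.
Unshelve. all: by end_near. Qed.

End Quadric.

(** * The pseudo-sphere and its hypersurfaces *)

(** Both sides are velocities along one curve that stays in [M] near 0. This makes it possible to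
    differentiate identities that hold on [M] only. *)
Lemma derive_tangent (R : realType) n (U : normedModType R) (M : set 'rV[R]_n)
    p v (F G : 'rV[R]_n -> U) :
  tangent M p v -> differentiable F p -> differentiable G p ->
  (\forall x \near p, M x -> F x = G x) -> 'D_v F p = 'D_v G p.
Proof.
case=> cv [c0 nM Dc] dF dG FG.
rewrite (deriveE v dF) (deriveE v dG).
have dF0 : differentiable F (cv 0) by rewrite c0.
have dG0 : differentiable G (cv 0) by rewrite c0.
have DF := is_derive_comp_curve dF0 Dc.
have [_ eG] := is_derive_comp_curve dG0 Dc.
have cc : {for (0 : R), continuous cv}.
  by apply: differentiable_continuous; have [] := is_derive_curve Dc.
have nFG : \forall t \near (0 : R), (F \o cv) t = (G \o cv) t.
  have H : \forall t \near (0 : R), M (cv t) -> F (cv t) = G (cv t).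
    by move: FG; rewrite -c0 => /cc.
  by apply: filterS2 H nM => t Ht Mt; exact: Ht.
have [_ eF] := near_eq_is_derive nFG DF.
by rewrite c0 in eF eG; exact: etrans (esym eF) eG.
Qed.

Lemma vfield_sub (R : realType) n (M W W' : set 'rV[R]_n) X :
  open W' -> W' `<=` W -> vfield M W X -> vfield M W' X.
Proof.
move=> oW' sW [oW sX tX]; split => //; first exact: smooth_sub sX.
by move=> x /sW; exact: tX.
Qed.

Section PseudoSphere.
Variables (R : realType) (N q : nat).
Let S : set 'rV[R]_N := psphere N q 1.
Local Notation sc := (@scal R N q).

Lemma tangent_psphere x v : S x -> tangent S x v <-> sc x v = 0.
Proof.
move=> Sx; rewrite (@tangent_quadric _ _ _ q 1%:M 1 S) //.
  by rewrite /gram !mulmx1.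
move=> u; rewrite /gram; split => [Su|[]]; last by rewrite !mulmx1.
by rewrite mulmx1; split => //; exists u; rewrite mulmx1 Su oner_eq0.
Qed.

Lemma vfield_psphere_proj W (X : 'rV[R]_N -> 'rV[R]_N) : open W ->
  smooth_on W X -> vfield S W (fun y => X y - sc (X y) y *: y).
Proof.
move=> oW sX; split => //.
  apply: smoothD => //; apply: smoothN => //; apply: smooth_scale => //.
    by apply: smooth_scal => //; exact: smooth_id.
  exact: smooth_id.
move=> y Wy Sy; apply/tangent_psphere => //.
by rewrite !scalE [sc y y]Sy mulr1 [sc y _]scalC subrr.
Qed.

(** Differentiate [<Y y, y> = 0], an identity valid on the sphere only, in the tangent direction
    [X x]. *)
Lemma psphere_derive_normal W X Y x : vfield S W X -> vfield S W Y ->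
  W x -> S x -> sc x ('D_(X x) Y x) = - sc (X x) (Y x).
Proof.
move=> [oW sX tX] [_ sY tY] Wx Sx.
have sF : smooth_on W (fun y => sc (Y y) y).
  by apply: smooth_scal => //; exact: smooth_id.
have H : 'D_(X x) (fun y => sc (Y y) y) x = 'D_(X x) (cst (0 : R)) x.
  apply: derive_tangent (tX _ Wx Sx) (smooth_differentiable sF Wx) _ _.
    exact: differentiable_cst.
  apply: filterS (open_nbhs_nbhs (conj oW Wx)) => y Wy Sy.
  by rewrite scalC; apply/tangent_psphere => //; exact: tY.
have dY := @diff_derivable _ _ _ _ _ (X x) (smooth_differentiable sY Wx).
have [_ D2] := is_derive_scal q (derivableP dY) (is_derive_id x (X x)).
move: H; rewrite D2 derive_cst => /eqP; rewrite addr_eq0 => /eqP.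
by rewrite scalC => ->; rewrite scalC.
Qed.

(* Koszul: the difference T of the two connections gives a trilinear form
   <T X Y, Z> symmetric in X, Y and skew in Y, Z, hence zero. *)
Lemma psphere_levi_civita nabla W X Y x : levi_civita q S nabla ->
  vfield S W X -> vfield S W Y -> W x -> S x ->
  nabla X Y x = 'D_(X x) Y x + sc (X x) (Y x) *: x.
Proof.
move=> LC vX vY Wx Sx.
have oW : open W by case: vX.
pose T X Y := nabla X Y x - ('D_(X x) Y x + sc (X x) (Y x) *: x).
suff T0 : T X Y = 0 by apply/eqP; rewrite -subr_eq0; apply/eqP.
have Tsym U V : vfield S W U -> vfield S W V -> T U V = T V U.
  move=> vU vV; apply/eqP; rewrite -subr_eq0 /T; apply/eqP.
  have := lc_torsion LC vU vV Wx Sx; rewrite [sc (V x) _]scalC => H.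
  have -> : forall a b c d e : 'rV[R]_N,
      a - (b + c) - (d - (e + c)) = (a - d) - (b - e).
    by move=> *; apply/rowP => i; rewrite !mxE; ring.
  by rewrite H subrr.
have Ttan U V : vfield S W U -> vfield S W V -> sc (T U V) x = 0.
  move=> vU vV; rewrite /T !scalE scalC.
  have [_ /(_ _ Wx Sx)/(tangent_psphere _ Sx) ->] := lc_vfield LC vU vV.
  by rewrite scalC (psphere_derive_normal vU vV Wx Sx) [sc x x]Sx mulr1 addNr subr0.
have Tskew U V Z : vfield S W U -> vfield S W V -> vfield S W Z ->
    sc (T U V) (Z x) = - sc (T U Z) (V x).
  move=> vU vV vZ; have := lc_metric LC vU vV vZ Wx Sx.
  have [_ sV tV] := vV; have [_ sZ tZ] := vZ.
  have dV := @diff_derivable _ _ _ _ _ (U x) (smooth_differentiable sV Wx).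
  have dZ := @diff_derivable _ _ _ _ _ (U x) (smooth_differentiable sZ Wx).
  have [_ ->] := is_derive_scal q (derivableP dV) (derivableP dZ).
  have /(tangent_psphere _ Sx) xV := tV _ Wx Sx.
  have /(tangent_psphere _ Sx) xZ := tZ _ Wx Sx.
  rewrite /T !scalE xV xZ !mulr0 !addr0 [sc _ (V x)]scalC [sc ('D_(U x) Z x) _]scalC.
  by move=> H; apply/eqP; rewrite -subr_eq0 opprK; apply/eqP; move: H; lra.
have vfZ v : vfield S W (fun y => v - sc v y *: y).
  by apply: vfield_psphere_proj => //; exact: smooth_cst.
(* The ambient form is tested against an arbitrary [v], split into a multiple of [x], to which
   [T X Y] is orthogonal, and a tangent part, which extends to the field [Z]. *)
apply: (@scal_nondegenerate _ _ q) => v.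
pose Z y := v - sc v y *: y.
have -> : v = Z x + sc v x *: x by rewrite subrK.
rewrite scalDr scalZr Ttan // mulr0 addr0.
have vZ : vfield S W Z by exact: vfZ.
(* Symmetry and skewness alternate three times each: the arguments return to their original order
   with three changes of sign. *)
have e : sc (T X Y) (Z x) = - sc (T X Y) (Z x).
  rewrite {1}Tsym // Tskew // Tsym // Tskew // Tsym // Tskew //.
  by rewrite !opprK.
by move: e; lra.
Qed.

End PseudoSphere.

(** * Tangent spaces of hypersurfaces of the pseudo-sphere *)

Section Hypersurfaces.
Variables (R : realType) (N q : nat).
Let S : set 'rV[R]_N := psphere N q 1.
Local Notation sc := (@scal R N q).

(* Inverse stereographic projection from - x onto the tangent space at x. *)
Definition stereo (x y : 'rV[R]_N) : 'rV[R]_N := - x + 4 * (4 + sc y y)^-1 *: (2 *: x + y).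

Definition stereo_dom : set 'rV[R]_N := [set y | 4 + sc y y != 0].

Lemma stereo_smooth x : open stereo_dom /\ smooth_on stereo_dom (stereo x).
Proof.
have oT : open (setT : set 'rV[R]_N) by exact: openT.
have sf : smooth_on setT (fun y : 'rV[R]_N => 4 + sc y y).
  apply: smoothD => //; first exact: smooth_cst.
  by apply: smooth_scal => //; exact: smooth_id.
have od : open stereo_dom by have := smooth_open_neq0 oT sf; rewrite setTI.
split => //; apply: smoothD => //; first exact: smooth_cst.
apply: smooth_scale => //.
  apply: smoothM => //; first exact: smooth_cst.
  by apply: smoothV => //; exact: smooth_sub sf.
by apply: smoothD => //; [exact: smooth_cst|exact: smooth_id].
Qed.

(** On the line from [- x] through [x + y] the square of [- x + l (2 x + y)] is
    [1 - 4 l + l^2 (4 + <y, y>)]; the factor in [stereo] is the nonzero [l] for which it is 1. *)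
Lemma stereo_sphere x y : S x -> sc x y = 0 -> stereo_dom y -> S (stereo x y).
Proof.
rewrite /S /psphere /stereo_dom /stereo /= => Sx xy d.
rewrite !scalE Sx xy [sc y x]scalC xy.
by move: d; set g := sc y y => d; field.
Qed.

Lemma stereo_dom0 : stereo_dom 0.
Proof. by rewrite /stereo_dom /= scal0l addr0 pnatr_eq0. Qed.

Lemma stereo0 x : stereo x 0 = x.
Proof.
rewrite /stereo scal0l !addr0 divff ?pnatr_eq0 // scale1r.
by rewrite scaler_nat mulr2n addKr.
Qed.

(** The scalar factor depends on [y] through the quadratic form alone, so it is stationary at 0,
    with value 1; only the term [2 x + y] contributes. *)
Lemma diff_stereo x v : 'd (stereo x) 0 v = v.
Proof.
have [od ss] := stereo_smooth x.
have ds := smooth_differentiable ss stereo_dom0.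
have Dq : is_derive (0 : 'rV[R]_N) v (fun y => 4 + sc y y) 0.
  apply: is_derive_eq (is_deriveD (is_derive_cst (4 : R) 0 v)
    (is_derive_scal q (is_derive_id 0 v) (is_derive_id 0 v))) _.
  by rewrite scal0l scal0r !addr0.
have q0 : 4 + sc 0 0 != 0 := stereo_dom0.
have DV : is_derive (0 : 'rV[R]_N) v (fun y => (4 + sc y y)^-1) 0.
  have [dq eq] := Dq; split; first exact: derivableV.
  by rewrite deriveV // eq scaler0.
have Dl : is_derive (0 : 'rV[R]_N) v (fun y => 4 * (4 + sc y y)^-1) 0.
  apply: is_derive_eq (@is_deriveZ _ _ _ _ (4 : R) _ _ _ DV) _.
  by rewrite scaler0.
have oT : open (setT : set 'rV[R]_N) by exact: openT.
have sl : smooth_on stereo_dom (fun y : 'rV[R]_N => 4 * (4 + sc y y)^-1).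
  apply: smoothM => //; first exact: smooth_cst.
  apply: smoothV => //; apply: smoothD => //; first exact: smooth_cst.
  by apply: smooth_scal => //; exact: smooth_id.
have sm : smooth_on stereo_dom (fun y : 'rV[R]_N => 2 *: x + y).
  by apply: smoothD => //; [exact: smooth_cst|exact: smooth_id].
have [dlm Dlm] := differentiable_scale (smooth_differentiable sl stereo_dom0)
  (smooth_differentiable sm stereo_dom0).
rewrite -deriveE // /stereo.
have [_ ->] := is_deriveD (is_derive_cst (- x) 0 v)
  (derivableP (diff_derivable (v := v) dlm)).
have [_ eD] := is_deriveD (is_derive_cst (2 *: x) 0 v) (is_derive_id 0 v).
rewrite add0r Dlm eD add0r; have [_ ->] := Dl.
by rewrite scale0r add0r scal0l addr0 divff ?pnatr_eq0 // scale1r.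
Qed.

Lemma is_derive_little (s : R -> R) : s 0 = 0 ->
  (forall e, 0 < e -> \forall t \near (0 : R), `|s t| <= e * `|t|) ->
  is_derive (0 : R) (1 : R) s 0.
Proof.
move=> s0 H.
have C : h^-1 *: (s (h *: 1 + 0) - s 0) @[h --> (0 : R)^'] --> (0 : R).
  apply/cvgrPdist_le => e e0.
  near=> t; rewrite sub0r normrN s0 subr0 addr0.
  rewrite -![_ *: _]/(_ * _) mulr1 normrM normfV ler_pdivrMl; last first.
    by rewrite normr_gt0; near: t; exact: nbhs_dnbhs_neq.
  rewrite mulrC; near: t; apply: nbhs_dnbhs; exact: H.
split; first by apply/cvg_ex; exists 0.
exact: cvg_lim C.
Unshelve. all: by end_near. Qed.

(* The intermediate value theorem gives a root s t with |s t| <= |t|; since F is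
   differentiable at 0, any such root is o(t). *)
Lemma implicit_curve (F : 'rV[R]_N -> R) (v eta : 'rV[R]_N) :
  differentiable F 0 -> (\forall y \near (0 : 'rV[R]_N), {for y, continuous F}) ->
  F 0 = 0 -> 'd F 0 v = 0 -> 'd F 0 eta = 1 ->
  exists s : R -> R, [/\ s 0 = 0, is_derive (0 : R) (1 : R) s 0 &
    \forall t \near (0 : R), F (t *: v + s t *: eta) = 0].
Proof.
move=> dF cF F0 Fv Fe.
pose K := `|v| + `|eta| + 1.
have K0 : 0 < K by rewrite ltr_wpDl // addr_ge0.
pose y t s := t *: v + s *: eta.
have dFy t s : 'd F 0 (y t s) = s.
  by rewrite /y linearD !linearZ /= Fv Fe scaler0 add0r -[_ *: _]/(_ * _) mulr1.
have ny t s : `|s| <= `|t| -> `|y t s| <= K * `|t|.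
  move=> st; rewrite /y (le_trans (ler_normD _ _)) // !normrZ.
  have H1 : `|s| * `|eta| <= `|t| * `|eta| by exact: ler_wpM2r.
  have : 0 <= `|t| by [].
  rewrite /K; move: H1; set a := `|t| * `|eta|; set b := `|s| * _ => H1 H2.
  by rewrite !mulrDl [`|eta| * _]mulrC -/a [`|v| * _]mulrC; lra.
(* The differential at 0 maps [y t s] to [s], so [F (y t s) = s + o(t)], uniformly over
   [|s| <= |t|]. *)
have small e : 0 < e -> exists2 d : R, 0 < d &
    forall t s, `|t| < d -> `|s| <= `|t| -> `|F (y t s) - s| <= e * `|t|.
  move=> e0; have [_ eF] := (diff_locallyP _ _).1 dF.
  have /eqaddoP/(_ (e / K)) H := eF.
  have /nbhs_ballP [d d0 Hd] := H (divr_gt0 e0 K0).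
  exists (d / K) => [|t s td st]; first exact: divr_gt0.
  have yd : `|y t s| < d.
    by rewrite (le_lt_trans (ny _ _ st)) // mulrC -ltr_pdivlMr.
  have := Hd (y t s); rewrite -ball_normE /= sub0r normrN => /(_ yd).
  rewrite !fctE /= addr0 F0 add0r dFy => /le_trans; apply.
  rewrite -mulrA ler_pM2l // ler_pdivrMl //; exact: ny.
(* With error at most [|t| / 2], the values of [F] at [s = |t|] and [s = - |t|] have the sign of
   [s], as the intermediate value theorem requires. *)
have [d1 d10 H1] := small (1 / 2) (divr_gt0 ltr01 (ltr0Sn _ 1)).
have /nbhs_ballP [d2 d20 H2] := cF.
pose d := Num.min d1 (d2 / K).
have d0 : 0 < d by rewrite lt_min d10 divr_gt0.
have root t : `|t| < d -> exists s, `|s| <= `|t| /\ F (y t s) = 0.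
  rewrite lt_min => /andP[td1 td2].
  have cs : {within `[- `|t|, `|t|], continuous (fun s => F (y t s))}.
    apply: continuous_in_subspaceT => s /set_mem.
    rewrite /= in_itv /= -ler_norml => st.
    apply: (@continuous_comp _ _ _ (fun s => y t s) F).
      apply: differentiable_continuous.
      by have [] := is_derive_curve (is_derive_line (t *: v) eta s).
    apply: H2; rewrite -ball_normE /= sub0r normrN.
    by rewrite (le_lt_trans (ny _ _ st)) // mulrC -ltr_pdivlMr.
  have tt : - `|t| <= `|t| by have : 0 <= `|t| by []; lra.
  have Fp := H1 t `|t| td1; have Fn := H1 t (- `|t|) td1.
  rewrite normrN !normr_id in Fp Fn.
  have /Fp := lexx `|t|; have /Fn := lexx `|t|.
  rewrite !ler_norml => /andP[n1 n2] /andP[p1 p2].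
  have t0 : 0 <= `|t| by [].
  have Fneg : F (y t (- `|t|)) <= 0 by lra.
  have Fpos : 0 <= F (y t `|t|) by lra.
  have := IVT tt cs (v := 0).
  rewrite ge_min Fneg le_max Fpos orbT => /(_ isT)[s].
  by rewrite in_itv /= -ler_norml => st Fs; exists s.
(* The roots are chosen independently of each other: [tangent] asks only for a derivative at 0. The
   value 0 taken for large [t] is a filler. *)
have /choice [s Hs] : forall t, exists s, `|t| < d -> `|s| <= `|t| /\ F (y t s) = 0.
  move=> t; have [/root[s Hs]|_] := ltP `|t| d; first by exists s.
  by exists 0.
have s0 : s 0 = 0.
  have [] := Hs 0; rewrite ?normr0 // => sle _.
  by apply/eqP; rewrite -normr_le0.
have nd : \forall t \near (0 : R), `|t| < d.
  exact: nbhs0_lt.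
exists s; split => //; last first.
  by apply: filterS nd => t /Hs [].
apply: is_derive_little => // e e0.
have [d3 d30 H3] := small e e0.
have nd3 : \forall t \near (0 : R), `|t| < d3 by exact: nbhs0_lt.
apply: filterS2 nd nd3 => t /Hs [st Ft] td3.
by have := H3 _ _ td3 st; rewrite Ft sub0r normrN.
Unshelve. all: by end_near. Qed.

(** For the converse, [stereo x] transports the problem to the linear space orthogonal to [x]. That
    space contains [v] and [eta], so the curve from [implicit_curve] stays in it and its image stays
    on the sphere. *)
Lemma tangent_hypersurface (P W : set 'rV[R]_N) (f : 'rV[R]_N -> R) x v :
  P `<=` S -> open W -> W x -> P x -> smooth_on W f ->
  (forall y, W y -> S y -> (P y <-> f y = 0)) ->
  (exists2 eta, tangent S x eta & 'd f x eta <> 0) ->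
  tangent P x v <-> (sc x v = 0 /\ 'd f x v = 0).
Proof.
move=> PS oW Wx Px sf Pf [eta te fe].
have Sx := PS _ Px.
have df := smooth_differentiable sf Wx.
split => [tv|[xv fv]].
  split.
    apply/tangent_psphere => //; case: tv => c [c0 nP dc]; exists c; split => //.
    by apply: filterS nP => t; exact: PS.
  rewrite -deriveE // (derive_tangent (G := cst 0) tv) ?derive_cst //.
  apply: filterS (open_nbhs_nbhs (conj oW Wx)) => y Wy Py.
  by apply/Pf => //; exact: PS.
have xe : sc x eta = 0 by apply/tangent_psphere.
have [od ss] := stereo_smooth x.
pose F y := f (stereo x y).
have dfs : differentiable f (stereo x 0) by rewrite stereo0.
have ds := smooth_differentiable ss stereo_dom0.
have dF : differentiable F 0 by exact: (differentiable_comp ds dfs).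
have dFE y : 'd F 0 y = 'd f x y.
  apply: etrans (congr1 (fun g => g y) (diff_comp ds dfs)) _.
  change ('d f (stereo x 0) ('d (stereo x) 0 y) = 'd f x y).
  by rewrite (diff_stereo x y) (stereo0 x).
have nW : \forall y \near (0 : 'rV[R]_N), stereo_dom y /\ W (stereo x y).
  apply: filterI; first exact: (open_nbhs_nbhs (conj od stereo_dom0)).
  have cs := differentiable_continuous ds.
  by have := open_nbhs_nbhs (conj oW Wx); rewrite -{1}(stereo0 x) => /cs.
have cF : \forall y \near (0 : 'rV[R]_N), {for y, continuous F}.
  apply: filterS nW => y [dy Wy]; apply: differentiable_continuous.
  apply: differentiable_comp; first exact: smooth_differentiable ss dy.
  exact: smooth_differentiable sf Wy.
have F0 : F 0 = 0 by rewrite /F stereo0; apply/Pf.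
have fe0 : 'd f x eta != 0 by apply/eqP.
(* [eta] is rescaled to satisfy the normalisation of [implicit_curve]. *)
have Fe : 'd F 0 (('d f x eta)^-1 *: eta) = 1.
  by rewrite dFE linearZ /= -[_ *: _]/(_ * _) mulVf.
have Fv : 'd F 0 v = 0 by rewrite dFE.
have [s [s0 Ds ns]] := implicit_curve dF cF F0 Fv Fe.
set eta' := _ *: eta in ns.
pose y t := t *: v + s t *: eta'.
have Dy : is_derive (0 : R) (1 : R) y v.
  have := is_deriveD (is_derive_scale_curve (is_derive_id (0 : R) (1 : R))
    (is_derive_cst v (0 : R) (1 : R)))
    (is_derive_scale_curve Ds (is_derive_cst eta' (0 : R) (1 : R))).
  move=> H; apply: is_derive_eq H _.
  by rewrite !scaler0 scale1r scale0r !addr0.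
have y0 : y 0 = 0 by rewrite /y s0 !scale0r addr0.
have dsy : differentiable (stereo x) (y 0) by rewrite y0.
exists (stereo x \o y); split.
- by rewrite /= y0 stereo0.
- have cy : {for (0 : R), continuous y}.
    by apply: differentiable_continuous; have [] := is_derive_curve Dy.
  have ny : \forall t \near (0 : R), stereo_dom (y t) /\ W (stereo x (y t)).
    by move: nW; rewrite -{1}y0 => /cy.
  apply: filterS2 ny ns => t [dy Wy] Fy.
  have xy : sc x (y t) = 0 by rewrite !scalE xe xv !mulr0 addr0.
  exact/(Pf _ Wy (stereo_sphere Sx xy dy)).
- apply: is_derive_eq (is_derive_comp_curve dsy Dy) _.
  by rewrite y0 diff_stereo.
Qed.

End Hypersurfaces.

(** * Affine immersions of quadrics *)

(* The seven maps are affine, u |-> uA + w, on a level set u not in rad h,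
   h u u = c, of the possibly degenerate form h pulled back by A; the last
   factor E^{0,0,1} lies in rad h. *)
Record quadric_immersion (R : realType) (n N q : nat) (A : 'M[R]_(n, N))
    (w : 'rV[R]_N) (c : R) (M : set 'rV[R]_n) (phi : 'rV[R]_n -> 'rV[R]_N) :
    Prop := QuadricImmersion {
  qi_free : row_free A;
  qi_orth : forall u, scal q (u *m A) w = 0;
  qi_level : c + scal q w w = 1;
  qi_mem : forall u, M u <-> gram q A u u = c /\ exists z, gram q A u z != 0;
  qi_affine : phi = (fun u => u *m A + w) }.

Section QuadricImmersionTheory.
Variables (R : realType) (n N q : nat) (A : 'M[R]_(n, N)) (w : 'rV[R]_N).
Variables (c : R) (M : set 'rV[R]_n) (phi : 'rV[R]_n -> 'rV[R]_N).
Hypothesis Q : quadric_immersion q A w c M phi.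
Local Notation h := (gram q A).
Local Notation S := (psphere N q (1 : R)).

Let phiE u : phi u = u *m A + w. Proof. by rewrite (qi_affine Q). Qed.

Lemma qi_tangent p v : M p -> tangent M p v <-> h p v = 0.
Proof. by move=> Mp; apply: tangent_quadric Mp; exact: (qi_mem Q). Qed.

Lemma qi_scal_phi p v : scal q (phi p) (v *m A) = h p v.
Proof. by rewrite phiE scalDl [scal q w _]scalC (qi_orth Q) addr0. Qed.

Lemma qi_sphere p : M p -> S (phi p).
Proof.
move=> /(qi_mem Q) [pc _]; rewrite /psphere /= {2}phiE scalDr qi_scal_phi pc.
by rewrite phiE scalDl (qi_orth Q) add0r (qi_level Q).
Qed.

Lemma qi_smooth W : open W -> smooth_on W phi.
Proof.
move=> oW; rewrite (qi_affine Q); apply: smoothD => //; last exact: smooth_cst.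
by apply: smooth_mulmx => //; [exact: smooth_id|exact: smooth_cst].
Qed.

Lemma qi_differentiable p : differentiable phi p.
Proof.
by apply: (smooth_differentiable (W := setT)) => //; apply: qi_smooth; exact: openT.
Qed.

Lemma qi_diff p v : 'd phi p v = v *m A.
Proof.
have dA := linear_mx_differentiable (mulmxr A) p.
have D := is_deriveD (differentiable_is_derive v dA) (is_derive_cst w p v).
rewrite -deriveE; last exact: qi_differentiable.
rewrite (qi_affine Q); have [_ ->] := D.
by rewrite addr0 (diff_lin _ (@linear_mx_continuous _ _ _ _ (mulmxr A))).
Qed.

(* gdom is the set of u outside the radical of h, and gunit u is a smooth
   transverse direction: h u (gunit u) = 1. *)
Definition gdual (u : 'rV[R]_n) : 'rV[R]_n := \row_i h u (delta_mx 0 i).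

Definition gdom : set 'rV[R]_n := [set u | h u (gdual u) != 0].

Definition gunit (u : 'rV[R]_n) : 'rV[R]_n := (h u (gdual u))^-1 *: gdual u.

Lemma gram_row_sum u v : h u v = \sum_i v 0 i * h u (delta_mx 0 i).
Proof.
pose L v := h u v.
have lL : linear L by move=> a x y; rewrite /L gramDr gramZr.
pose LL : {linear 'rV[R]_n -> R} := HB.pack L (GRing.isLinear.Build _ _ _ _ _ lL).
rewrite -[LHS]/(LL v) {1}(row_sum_delta v) linear_sum.
by apply: eq_bigr => i _; rewrite linearZ.
Qed.

(** [gdual u] lists the coordinates of the covector [h u], so [h u (gdual u)] is the sum of their
    squares. A single smooth function thus detects membership in the radical, although [h] is
    indefinite. *)
Lemma gdomP u : gdom u <-> exists z, h u z != 0.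
Proof.
split=> [?|[z hz]]; first by exists (gdual u).
apply: contra_neq hz => g0; rewrite gram_row_sum big1 // => i _.
have pos j : true -> 0 <= gdual u 0 j * h u (delta_mx 0 j).
  by move=> _; rewrite mxE -expr2 sqr_ge0.
move: g0; rewrite gram_row_sum => /(psumr_eq0P pos)/(_ i isT).
by rewrite mxE => /eqP; rewrite -expr2 sqrf_eq0 => /eqP ->; rewrite mulr0.
Qed.

Lemma qi_gdom u : M u -> gdom u.
Proof. by move=> /(qi_mem Q) [_ /gdomP]. Qed.

Lemma gunitE u : gdom u -> h u (gunit u) = 1.
Proof. by move=> d; rewrite gramZr mulVf. Qed.

Lemma smooth_gram W F G : open W -> smooth_on W F -> smooth_on W G ->
  smooth_on W (fun u : 'rV[R]_n => h (F u) (G u)).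
Proof.
by move=> oW sF sG; apply: smooth_scal => //; apply: smooth_mulmx => //;
  exact: smooth_cst.
Qed.

Lemma smooth_gdual W : open W -> smooth_on W gdual.
Proof.
move=> oW; apply: smooth_mx => // i j; under eq_fun do rewrite mxE.
by apply: smooth_gram => //; [exact: smooth_id|exact: smooth_cst].
Qed.

Lemma open_gdom : open gdom.
Proof.
have oT : open (setT : set 'rV[R]_n) by exact: openT.
have sg : smooth_on setT (fun u => h u (gdual u)).
  by apply: smooth_gram => //; [exact: smooth_id|exact: smooth_gdual].
by have := smooth_open_neq0 oT sg; rewrite setTI.
Qed.

Lemma smooth_gunit : smooth_on gdom gunit.
Proof.
have od := open_gdom; apply: smooth_scale => //; last exact: smooth_gdual.
apply: smoothV => //.
by apply: smooth_gram => //; [exact: smooth_id|exact: smooth_gdual].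
Qed.

Lemma qi_submanifold d : (1 + d = n)%N -> submanifold d M.
Proof.
move=> dn p Mp; exists 1%N, gdom, (fun u => const_mx (h u u - c)).
have od := open_gdom.
have sg : smooth_on gdom (fun u => h u u - c).
  apply: smoothD => //; last exact: smooth_cst.
  by apply: smooth_gram => //; exact: smooth_id.
have sF : smooth_on gdom (fun u => const_mx (h u u - c) : 'rV[R]_1).
  by apply: smooth_mx => // i j; under eq_fun do rewrite mxE.
split => //; first exact: qi_gdom.
move=> u du; split.
  rewrite (qi_mem Q); split => [[-> _]|H].
    by apply/rowP => i; rewrite !mxE subrr.
  split; last exact/gdomP.
  by move/rowP: H => /(_ 0) /eqP; rewrite !mxE subr_eq0 => /eqP.
(* The derivative of [h u u] along [gunit u] is 2, whence the half. *)
move=> _ a; exists ((a 0 0 / 2) *: gunit u).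
rewrite -deriveE; last exact: smooth_differentiable sF du.
set v := _ *: gunit u.
have dvA : is_derive u v (fun y : 'rV[R]_n => y *m A) (v *m A).
  have H := differentiable_is_derive v (linear_mx_differentiable (mulmxr A) u).
  apply: is_derive_eq H _.
  by rewrite (diff_lin _ (@linear_mx_continuous _ _ _ _ (mulmxr A))).
have D : is_derive u v (fun y => const_mx (h y y - c) : 'rV[R]_1) a.
  apply/is_derive_mxP => i j; rewrite !ord1.
  have H := is_deriveD (is_derive_scal q dvA dvA) (is_derive_cst (- c) u v).
  have -> : (fun y : 'rV[R]_n => (const_mx (h y y - c) : 'rV[R]_1) 0 0) =
      (fun y => scal q (y *m A) (y *m A)) + cst (- c).
    by apply/funext => y; rewrite mxE.
  apply: is_derive_eq H _; rewrite -/(h v u) -/(h u v) [h v u]gramC addr0.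
  by rewrite /v gramZr (gunitE du) mulr1 -splitr.
by have [_ ->] := D.
Qed.

Lemma qi_inj (v : 'rV[R]_n) : v *m A = 0 -> v = 0.
Proof. by move=> vA; apply: (row_free_inj (qi_free Q)); rewrite vA mul0mx. Qed.

Lemma qi_isometric_immersion d (g : 'rV[R]_n -> 'rV[R]_n -> R) :
  (1 + d = n)%N -> (forall u v, h u v = g u v) ->
  isometric_immersion d q M g S phi.
Proof.
move=> dn hg; split.
- exact: qi_submanifold.
- by exists setT; [exact: openT|split => //; apply: qi_smooth; exact: openT].
- exact: qi_sphere.
- by move=> p v Mp _; rewrite qi_diff; exact: qi_inj.
- by move=> p u v _ _ _; rewrite /induced_metric !qi_diff -hg.
Qed.

Lemma qi_complement : exists k (C : 'M[R]_(k, N)),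
  (forall y, exists (v : 'rV[R]_n) a, y = v *m A + a *m C) /\
  (forall (v : 'rV[R]_n) a, v *m A = a *m C -> a = 0).
Proof.
exists (\rank (A^C)%MS), (row_base (A^C)%MS); split => [y|v a vaC].
  have : (y <= A + row_base (A^C)%MS)%MS.
    rewrite (adds_eqmx (eqmx_refl A) (eq_row_base _)) submx_full //.
    exact: addsmx_compl_full.
  by move=> /sub_addsmxP [[v a] ->]; exists v, a.
apply: (row_free_inj (row_base_free (A^C)%MS)).
rewrite mul0mx -vaC; apply/eqP; rewrite -submx0 -(capmx_compl A) sub_capmx.
by rewrite submxMl vaC -(eq_row_base (A^C)%MS) submxMl.
Qed.

(* R^N is the direct sum of the range of A and of the rows of a constant matrix
   C; the rows of C are corrected along gunit u so as to be tangent to S. *)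
Lemma qi_transversal_bundle : exists tr, transversal_bundle M S phi tr.
Proof.
have [k [C [compl_dec compl_inj]]] := qi_complement.
pose E (u : 'rV[R]_n) : 'M[R]_(k, N) :=
  C - (\col_j scal q (row j C) (phi u)) *m (gunit u *m A).
have aE u a : a *m E u = a *m C - scal q (a *m C) (phi u) *: (gunit u *m A).
  have acol : a *m (\col_j scal q (row j C) (phi u)) = (scal q (a *m C) (phi u))%:M.
    apply/rowP => i; rewrite ord1 !mxE mulmx_sum_row.
    under eq_bigr do rewrite mxE.
    elim/big_rec2: _ => [|j x y _ ->]; first by rewrite scal0l.
    by rewrite scalDl scalZl.
  by rewrite mulmxBr [a *m (_ *m _)]mulmxA acol mul_scalar_mx.
have freeE u : row_free (E u).
  rewrite -kermx_eq0; apply/rowV0P => a /sub_kermxP.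
  rewrite aE => /eqP; rewrite subr_eq0 scalemxAl => /eqP/esym/compl_inj.
  exact.
have scE u a : M u -> scal q (phi u) (a *m E u) = 0.
  move=> Mu; rewrite aE !scalE qi_scal_phi (gunitE (qi_gdom Mu)) mulr1.
  by rewrite scalC subrr.
exists (fun u => [set b | (b <= E u)%MS]); split.
- move=> p Mp; exists k, gdom, E; split => //.
  + exact: open_gdom.
  + exact: qi_gdom.
  + have od := open_gdom; apply: smoothD => //; first exact: smooth_cst.
    apply: smoothN => //; apply: smooth_mulmx => //.
      apply: smooth_mx => // i j; under eq_fun do rewrite mxE.
      by apply: smooth_scal => //; [exact: smooth_cst|exact: qi_smooth].
    by apply: smooth_mulmx => //; [exact: smooth_gunit|exact: smooth_cst].
- move=> p b Mp /submxP [a ->]; apply/tangent_psphere; first exact: qi_sphere.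
  exact: scE.
- move=> p y Mp /(tangent_psphere _ (qi_sphere Mp)) py.
  have [v [a yE]] := compl_dec y.
  pose v' := v + scal q (a *m C) (phi p) *: gunit p.
  have yE' : y = v' *m A + a *m E p.
    by rewrite yE aE mulmxDl -scalemxAl addrACA subrr addr0.
  exists v', (a *m E p); split => //; last 2 first.
  + exact: submxMl.
  + by rewrite qi_diff.
  apply/(qi_tangent _ Mp).
  by rewrite -qi_scal_phi; move: py; rewrite yE' scalDr scE // addr0.
- move=> p v Mp tv; rewrite qi_diff => /submxP [a vE].
  have a0 : a = 0.
    move: vE; rewrite aE => /eqP; rewrite -subr_eq opprK scalemxAl -mulmxDl.
    by move=> /eqP/compl_inj.
  by rewrite vE a0 mul0mx.
Qed.

Lemma qi_pinv u : (phi u *m pinvmx A - w *m pinvmx A) = u.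
Proof. by rewrite phiE mulmxDl addrK -mulmxA mulmxVp ?mulmx1 // (qi_free Q). Qed.

(** [A] has a right inverse, so [y |-> (y - w) *m pinvmx A] inverts [phi] on its image. The field is
    pulled back by this affine map, pushed forward by [A] and projected to the sphere; along [phi]
    the projection changes nothing because [h x (X x) = 0]. *)
Lemma qi_extension W X p : vfield M W X -> W p -> M p ->
  exists Wb Xb, [/\ vfield S Wb Xb, Wb (phi p) &
    \forall x \near p, M x -> Xb (phi x) = X x *m A].
Proof.
move=> [oW sX tX] Wp Mp.
pose L : {linear 'rV[R]_N -> 'rV[R]_n} := mulmxr (pinvmx A).
pose d := - (w *m pinvmx A).
pose Wb := [set y | W (L y + d)].
pose Xt y := X (L y + d) *m A.
have cL : continuous L by exact: linear_mx_continuous.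
have oWb : open Wb.
  have cLd : continuous (fun y => L y + d).
    move=> y; apply: (@continuousD _ _ _ L (cst d)); [exact: cL|exact: cst_continuous].
  exact: (open_comp (fun y _ => cLd y) oW).
have Lphi u : L (phi u) + d = u by exact: qi_pinv.
have sXt : smooth_on Wb Xt.
  by apply: smooth_mulmx => //; [exact: smooth_precomp|exact: smooth_cst].
exists Wb, (fun y => Xt y - scal q (Xt y) y *: y); split.
- exact: vfield_psphere_proj.
- by rewrite /Wb /= Lphi.
- apply: filterS (open_nbhs_nbhs (conj oW Wp)) => x Wx Mx.
  have /(qi_tangent _ Mx) hx := tX _ Wx Mx.
  by rewrite /Xt Lphi [scal _ _ _]scalC qi_scal_phi hx scale0r subr0.
Qed.

(* Modulo the range of A, the derivative of Yb along phi vanishes, so that only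
   the normal term of the sphere, h X Y (pA + w), remains. *)
Lemma qi_nabla nabla W X Y p Xb Yb : levi_civita q S nabla ->
  W (phi p) -> vfield S W Xb -> vfield S W Yb -> M p ->
  tangent M p (X p) ->
  (\forall x \near p, M x -> Xb (phi x) = X x *m A) ->
  (\forall x \near p, M x -> Yb (phi x) = Y x *m A) ->
  scal q (phi p) (nabla Xb Yb (phi p)) = 0 /\
  exists v, nabla Xb Yb (phi p) = v *m A + h (X p) (Y p) *: w.
Proof.
move=> LC Wp vX vY Mp tX eX eY; have Sp := qi_sphere Mp; split.
  by apply/tangent_psphere => //; have [_] := lc_vfield LC vX vY; apply.
rewrite (psphere_levi_civita LC vX vY Wp Sp).
rewrite (nbhs_singleton eX Mp) (nbhs_singleton eY Mp) -/(h _ _).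
set D := 'D_ _ _ _.
suff /submxP [v ->] : (D <= A)%MS.
  exists (v + h (X p) (Y p) *: p).
  by rewrite phiE scalerDr addrA mulmxDl -scalemxAl.
have -> : (D <= A)%MS = (D *m cokermx A == 0) by rewrite submxE.
apply/eqP.
have [_ sY _] := vY.
have dY := smooth_differentiable sY Wp.
pose G : {linear 'rV[R]_N -> 'rV[R]_N} := mulmxr (cokermx A).
have dG y : differentiable G y by exact: linear_mx_differentiable.
have dphi := qi_differentiable p.
have dYphi := differentiable_comp dphi dY.
have dGY := differentiable_comp dYphi (dG (Yb (phi p))).
have -> : D *m cokermx A = 'D_(X p) (G \o (Yb \o phi)) p.
  rewrite (deriveE _ dGY) (diff_comp dYphi (dG _)) [RHS]/=.
  rewrite (diff_lin _ (@linear_mx_continuous _ _ _ _ G)) (diff_comp dphi dY) /=.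
  by rewrite qi_diff /D (deriveE _ dY).
rewrite (derive_tangent (G := cst 0) tX dGY) ?derive_cst //.
apply: filterS eY => x eY Mx /=.
by rewrite eY // -mulmxA mulmx_coker mulmx0.
Qed.

(** [nabla_bar] picks some value obtained from extensions. Such values exist by [qi_extension], and
    [qi_nabla] applies to every one of them, hence to the one picked. *)
Lemma qi_nabla_bar nabla W X Y p : levi_civita q S nabla ->
  vfield M W X -> vfield M W Y -> W p -> M p ->
  let y := nabla_bar M S phi nabla X Y p in
  scal q (phi p) y = 0 /\ exists v, y = v *m A + h (X p) (Y p) *: w.
Proof.
move=> LC vX vY Wp Mp y; rewrite /y /nabla_bar.
set E := [set _ | _].
have : E (xget 0 E).
  apply: xgetPex.
  have [WX [Xb [vXb WXp eX]]] := qi_extension vX Wp Mp.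
  have [WY [Yb [vYb WYp eY]]] := qi_extension vY Wp Mp.
  exists (nabla Xb Yb (phi p)), Xb, Yb; split => //.
    split; first by exists WX.
    by apply: filterS eX => x + Mx; rewrite qi_diff; apply.
  split; first by exists WY.
  by apply: filterS eY => x + Mx; rewrite qi_diff; apply.
move=> [Xb [Yb [[[WX WXp vXb] eX] [[WY WYp vYb] eY] ->]]].
have oW : open (WX `&` WY) by apply: openI; [case: vXb|case: vYb].
apply: (qi_nabla (W := WX `&` WY)) => //.
- by apply: vfield_sub oW _ vXb; exact: subIsetl.
- by apply: vfield_sub oW _ vYb; exact: subIsetr.
- by case: vX => _ _; apply.
- by apply: filterS eX => x + Mx; rewrite qi_diff; apply.
- by apply: filterS eY => x + Mx; rewrite qi_diff; apply.
Qed.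

(** * The section of an arbitrary transversal bundle congruent to w *)

Section TransversalBundle.
Variable tr : 'rV[R]_n -> set 'rV[R]_N.
Hypothesis TB : transversal_bundle M S phi tr.

Lemma tr_lin p a b b' : M p -> tr p b -> tr p b' -> tr p (a *: b + b').
Proof.
move=> Mp; have [k [W [E [oW Wp sE trE]]]] := tb_frame TB Mp.
have [_ ->] := trE _ Wp Mp.
by move=> /= bE b'E; rewrite addmx_sub // scalemx_sub.
Qed.

(** The difference lies in the fibre, so it is tangent to the sphere; this forces [h p v = 0], and
    [v *m A] is then both tangent to the immersion and transversal. *)
Lemma tr_unique p b b' v : M p -> tr p b -> tr p b' -> b - b' = v *m A -> b = b'.
Proof.
move=> Mp tb tb' bv; apply/eqP; rewrite -subr_eq0 bv -(qi_diff p); apply/eqP.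
have tbb : tr p (b - b') by rewrite addrC -scaleN1r; exact: tr_lin.
apply: (tb_direct TB) => //; last by rewrite qi_diff -bv.
apply/(qi_tangent _ Mp); rewrite -qi_scal_phi -bv.
by apply/tangent_psphere; [exact: qi_sphere|exact: (tb_sub TB) tbb].
Qed.

Lemma tr_exists p : M p -> exists b v, tr p b /\ b - w = v *m A.
Proof.
move=> Mp.
have hg := gunitE (qi_gdom Mp).
have [pc _] := (qi_mem Q p).1 Mp.
(* [w] alone has product [1 - c] with [phi p]. Adding [p *m A] contributes [c] and subtracting
   [gunit p *m A] removes 1, so the result is tangent and still congruent to [w]. *)
have : tangent S (phi p) ((p - gunit p) *m A + w).
  apply/tangent_psphere; first exact: qi_sphere.
  rewrite scalDr qi_scal_phi gramDr gramNr pc hg phiE scalDl (qi_orth Q) add0r.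
  by have := qi_level Q; lra.
move=> /(tb_sum TB Mp) [v [b [tv tb e]]].
exists b, (p - gunit p - v); split => //.
rewrite mulmxBl; move: e; rewrite qi_diff => e.
have -> : b = (p - gunit p) *m A + w - v *m A by rewrite e addrAC subrr add0r.
by rewrite addrAC addrK.
Qed.

Definition mean_curv (p : 'rV[R]_n) : 'rV[R]_N :=
  xget 0 [set b | tr p b /\ exists v, b - w = v *m A].

Lemma mean_curvP p : M p ->
  tr p (mean_curv p) /\ exists v, mean_curv p - w = v *m A.
Proof.
move=> Mp; apply: (@xgetPex _ 0 [set b | tr p b /\ exists v, b - w = v *m A]).
by have [b [v [tb e]]] := tr_exists Mp; exists b; split => //; exists v.
Qed.

(* With G = cokermx A and H the mean curvature section, H = a E for the unique a
   with a E G = w G, and E G has the right inverse (E G)^T ((E G) (E G)^T)^-1. *)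
Lemma mean_curv_smooth : smooth_along M mean_curv.
Proof.
move=> p Mp; have [k [W [E [oW Wp sE trE]]]] := tb_frame TB Mp.
pose G := cokermx A.
pose EG x := E x *m G.
pose B x := EG x *m (EG x)^T.
have sEG : smooth_on W EG by apply: smooth_mulmx => //; exact: smooth_cst.
have sB : smooth_on W B.
  by apply: smooth_mulmx => //; exact: smooth_trmx.
(* [a *m B x *m a^T] is the Euclidean square of [a *m EG x]. So [a *m B x = 0] puts [a *m E x] in
   the range of [A], and [tr_unique] makes it vanish. *)
have uB x : W x -> M x -> B x \in unitmx.
  move=> Wx Mx; rewrite -row_free_unit -kermx_eq0; apply/rowV0P => a /sub_kermxP aB.
  have [fE trx] := trE _ Wx Mx.
  have aEG : a *m EG x = 0.
    apply/rowP => i; rewrite [RHS]mxE.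
    have : (a *m EG x *m (a *m EG x)^T) 0 0 = 0.
      have -> : a *m EG x *m (a *m EG x)^T = a *m B x *m a^T.
        by rewrite trmx_mul /B !mulmxA.
      by rewrite aB mul0mx mxE.
    have pos j : true -> 0 <= (a *m EG x) 0 j * (a *m EG x)^T j 0.
      by move=> _; rewrite [X in _ * X]mxE -expr2 sqr_ge0.
    rewrite mxE => /(psumr_eq0P pos)/(_ i isT).
    by rewrite [X in _ * X]mxE => /eqP; rewrite -expr2 sqrf_eq0 => /eqP.
  have /submxP [v aEv] : (a *m E x <= A)%MS by rewrite submxE -mulmxA; apply/eqP.
  apply: (row_free_inj fE); rewrite mul0mx.
  apply: (tr_unique (v := v) Mx); rewrite ?subr0 //.
    by rewrite trx /= submxMl.
  by rewrite trx /= sub0mx.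
pose W' := W `&` [set x | \det (B x) != 0].
have oW' : open W' by apply: smooth_open_neq0 => //; exact: smooth_det.
have W'W : W' `<=` W by exact: subIsetl.
exists W', (fun x => w *m G *m ((EG x)^T *m (invmx (B x) *m E x))); split => //.
- by split => //=; rewrite -unitfE -unitmxE; exact: uB.
- apply: smooth_mulmx => //; first exact: smooth_cst.
  apply: smooth_mulmx => //; first by apply: smooth_trmx => //; exact: smooth_sub sEG.
  apply: smooth_mulmx => //; last exact: smooth_sub sE.
  apply: smooth_invmx => //; last exact: smooth_sub sB.
  by move=> x [_ /=]; rewrite unitmxE unitfE.
- move=> x [Wx _] Mx; have [trH [v Hv]] := mean_curvP Mx.
  have [fE trx] := trE _ Wx Mx.
  move: trH; rewrite trx /= => /submxP [a Ha].
  have aEG : a *m EG x = w *m G.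
    apply/eqP; rewrite -subr_eq0 mulmxA -Ha -mulmxBl Hv -mulmxA.
    by rewrite mulmx_coker mulmx0.
  rewrite -aEG.
  have -> : a *m EG x *m ((EG x)^T *m (invmx (B x) *m E x)) =
      a *m B x *m invmx (B x) *m E x by rewrite /B !mulmxA.
  by rewrite mulmxK ?uB // Ha.
Qed.

(** Both bar-nabla_X Y and [h X Y *: mean_curv p] are tangent to the sphere and congruent to
    [h X Y *: w]. Their difference is thus the image of a tangent vector of [M], which is the
    required decomposition; [tr_unique] makes it the only one. *)
Lemma qi_second_form nabla W X Y p : levi_civita q S nabla ->
  vfield M W X -> vfield M W Y -> W p -> M p ->
  second_form M S phi nabla tr X Y p = h (X p) (Y p) *: mean_curv p.
Proof.
move=> LC vX vY Wp Mp.
have [py [v yE]] := qi_nabla_bar LC vX vY Wp Mp.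
rewrite /second_form; move: py yE; set y := nabla_bar _ _ _ _ _ _ _ => py yE.
have [tH [vH HE]] := mean_curvP Mp.
set b := h (X p) (Y p) in yE *.
have tbH : tr p (b *: mean_curv p).
  rewrite -[_ *: _]addr0; apply: tr_lin => //.
  by rewrite -(addNr (mean_curv p)) -scaleN1r; exact: tr_lin.
apply: xget_unique.
  split => //; exists (v - b *: vH).
    apply/(qi_tangent _ Mp).
    have := tb_sub TB Mp tbH => /(tangent_psphere _ (qi_sphere Mp)) sH.
    rewrite -qi_scal_phi mulmxBl -scalemxAl -HE scalerBr.
    have -> : v *m A - (b *: mean_curv p - b *: w) = y - b *: mean_curv p.
      by rewrite yE opprB addrA.
    by rewrite !scalE py sub0r; move: sH; rewrite scalZr => ->; rewrite oppr0.
  by rewrite qi_diff mulmxBl -scalemxAl -HE scalerBr opprB addrA -yE subrK.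
move=> b' [tb' [u tu yu]].
apply: (tr_unique (v := v - u - b *: vH) Mp) => //.
rewrite !mulmxBl -scalemxAl -HE; move: yu; rewrite qi_diff yE => yu.
rewrite scalerBr -[b'](addrK (u *m A)) [b' + _]addrC -yu.
by apply/rowP => i; rewrite !mxE; ring.
Qed.

End TransversalBundle.

Lemma qi_totally_umbilical nabla : levi_civita q S nabla ->
  totally_umbilical q M S phi nabla.
Proof.
move=> LC; split; first exact: qi_transversal_bundle.
move=> tr TB; exists (mean_curv tr); split.
- exact: mean_curv_smooth.
- by move=> p Mp; have [] := mean_curvP TB Mp.
- move=> W X Y vX vY p Wp Mp.
  by rewrite (qi_second_form TB LC vX vY Wp Mp) /induced_metric !qi_diff.
Qed.

Lemma qi_totally_geodesic nabla : w = 0 -> levi_civita q S nabla ->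
  totally_geodesic M S phi nabla.
Proof.
move=> w0 LC; split; first exact: qi_transversal_bundle.
move=> tr TB W X Y vX vY p Wp Mp.
rewrite (qi_second_form TB LC vX vY Wp Mp).
suff -> : mean_curv tr p = 0 by rewrite scaler0.
have [tH [v HE]] := mean_curvP TB Mp.
apply: (tr_unique TB (v := v) Mp) => //; last by rewrite -HE w0.
by rewrite -(addNr (mean_curv tr p)) -scaleN1r; exact: tr_lin.
Qed.

End QuadricImmersionTheory.

(** * Fullness and the rank of the radical *)

Section FullLightlike.
Variables (R : realType) (n N q : nat) (A : 'M[R]_(n, N)) (w : 'rV[R]_N).
Variables (c : R) (M : set 'rV[R]_n) (phi : 'rV[R]_n -> 'rV[R]_N).
Hypothesis Q : quadric_immersion q A w c M phi.
Local Notation h := (gram q A).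
Local Notation S := (psphere N q (1 : R)).
Local Notation z := (gunit q A).

Lemma qi_tangent_image (P : set 'rV[R]_N) p v :
  phi @` M `<=` P -> M p -> tangent M p v -> tangent P (phi p) (v *m A).
Proof.
move=> MP Mp [cv [c0 nM dc]]; exists (phi \o cv); split.
- by rewrite /= c0.
- by apply: filterS nM => t Mt; apply: MP; exists (cv t).
- have := is_derive_comp_curve (qi_differentiable Q (cv 0)) dc.
  by rewrite (qi_diff Q).
Qed.

(** A single tangent vector must become a field before the connection applies: the constant field is
    corrected along [gunit], and the correction vanishes at [p]. *)
Lemma qi_tangent_field X p : M p -> tangent M p X ->
  vfield M (gdom q A) (fun u => X - h u X *: z u) /\ X - h p X *: z p = X.
Proof.
move=> Mp /(qi_tangent Q _ Mp) hX; rewrite hX scale0r subr0; split => //.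
have od := open_gdom (q := q) (A := A); split => //.
  apply: smoothD => //; first exact: smooth_cst.
  apply: smoothN => //; apply: smooth_scale => //; last exact: smooth_gunit.
  by apply: smooth_gram => //; [exact: smooth_id|exact: smooth_cst].
move=> u du Mu; apply/(qi_tangent Q _ Mu).
by rewrite gramDr gramNr gramZr gunitE // mulr1 subrr.
Qed.

Section Hypersurface.
Variables (P W : set 'rV[R]_N) (f : 'rV[R]_N -> R) (p : 'rV[R]_n) (eta : 'rV[R]_N).
Hypotheses (PS : P `<=` S) (MP : phi @` M `<=` P) (Mp : M p).
Hypotheses (oW : open W) (Wp : W (phi p)) (sf : smooth_on W f).
Hypothesis Pf : forall y, W y -> S y -> (P y <-> f y = 0).
Hypotheses (teta : tangent S (phi p) eta) (feta : 'd f (phi p) eta <> 0).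

(** The derivative of [f] along [Z], expanded over the basis because [smooth_derive] gives
    smoothness in fixed directions. *)
Let df (Z : 'rV[R]_N -> 'rV[R]_N) y := \sum_i Z y 0 i * 'D_(delta_mx 0 i) f y.

Let dfE Z y : W y -> df Z y = 'd f y (Z y).
Proof.
move=> Wy; have dfy := smooth_differentiable sf Wy.
rewrite [in RHS](row_sum_delta (Z y)) linear_sum; apply: eq_bigr => i _.
by rewrite linearZ /= deriveE.
Qed.

Let smooth_df W' Z : open W' -> W' `<=` W -> smooth_on W' Z -> smooth_on W' (df Z).
Proof.
move=> oW' sW sZ; apply: smooth_sum => // i; apply: smoothM => //.
  exact: smooth_coord.
by apply: smooth_derive; exact: smooth_sub sf.
Qed.

Let etaf y := eta - scal q eta y *: y.

(** Here [etaf], the projection of [eta] that is tangent to the sphere, is still transverse to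
    [P]. *)
Let dom : set 'rV[R]_N := W `&` [set y | df etaf y != 0].

Let smooth_etaf W' : open W' -> smooth_on W' etaf.
Proof.
move=> oW'; apply: smoothD => //; first exact: smooth_cst.
apply: smoothN => //; apply: smooth_scale => //; last exact: smooth_id.
by apply: smooth_scal => //; [exact: smooth_cst|exact: smooth_id].
Qed.

Let tangent_etaf y : S y -> scal q y (etaf y) = 0.
Proof.
move=> Sy; rewrite /etaf !scalE [scal q y y]Sy mulr1 [scal q y eta]scalC.
by rewrite subrr.
Qed.

Let open_dom : open dom.
Proof. by apply: smooth_open_neq0 => //; apply: smooth_df => //; exact: smooth_etaf. Qed.

Let dom_p : dom (phi p).
Proof.
split => //=; rewrite dfE //.
have /tangent_psphere e0 := teta; have Sp := qi_sphere Q Mp.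
by rewrite /etaf [scal _ _ _]scalC (e0 Sp) scale0r subr0; apply/eqP.
Qed.

Let tangent_P y v : dom y -> P y ->
  tangent P y v <-> (scal q y v = 0 /\ 'd f y v = 0).
Proof.
move=> [Wy ey] Py; have Sy := PS Py.
apply: (@tangent_hypersurface _ _ q P W f) => //.
exists (etaf y); first by apply/tangent_psphere => //; exact: tangent_etaf.
by rewrite -dfE //; apply/eqP.
Qed.

(** Total geodesy of [P] concerns fields tangent to the sphere and to [P] at once. Subtracting a
    multiple of [etaf] kills the derivative of [f]; along [phi] that multiple is 0, since the image
    lies in [P]. *)
Lemma qi_hypersurface_extension U X : vfield M U X -> U p ->
  exists Wb Xb, [/\ vfield S Wb Xb, vfield P Wb Xb, Wb (phi p) &
    \forall x \near p, M x -> Xb (phi x) = X x *m A].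
Proof.
move=> vX Up; have [Wb [Xb [vXb Wbp eX]]] := qi_extension Q vX Up Mp.
have [oWb sXb tXb] := vXb.
pose W' := Wb `&` dom.
have oW' : open W' by exact: openI.
have W'W : W' `<=` W by move=> y [_ []].
have W'Wb : W' `<=` Wb by exact: subIsetl.
pose Xc y := Xb y - (df Xb y * (df etaf y)^-1) *: etaf y.
have sXc : smooth_on W' Xc.
  have se := smooth_etaf oW'.
  have sX := smooth_sub W'Wb sXb.
  apply: smoothD => //; apply: smoothN => //; apply: smooth_scale => //.
  apply: smoothM => //; first exact: smooth_df.
  by apply: smoothV => //; [move=> y [_ []]|exact: smooth_df].
have nXc y : W' y -> S y -> scal q y (Xc y) = 0.
  move=> [Wby _] Sy; rewrite /Xc scalDr scalNr scalZr tangent_etaf // mulr0 subr0.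
  by apply/tangent_psphere => //; exact: tXb.
exists W', Xc; split => //.
- by split => // y W'y Sy; apply/tangent_psphere => //; exact: nXc.
- split => // y W'y Py; have [_ dy] := W'y; have [Wy ey] := dy.
  apply/tangent_P => //; split; first by apply: nXc => //; exact: PS.
  rewrite linearB linearZ /= -dfE // -(dfE etaf Wy).
  by rewrite -[_ *: _]/(_ * _) mulfVK // subrr.
- have cphi := differentiable_continuous (qi_differentiable Q p).
  have nd : \forall x \near p, dom (phi x).
    by apply: cphi; exact: open_nbhs_nbhs.
  have nU : \forall x \near p, U x by apply: open_nbhs_nbhs; split => //; case: vX.
  near=> x => Mx.
  have dx : dom (phi x) by near: x.
  have Ux : U x by near: x.
  have Px : P (phi x) by apply: MP; exists x.
  have eXx : Xb (phi x) = X x *m A by move: Mx; near: x.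
  have tX : tangent M x (X x) by case: vX => _ _; apply.
  have /tangent_P [//|//|_ fX] := qi_tangent_image MP Mx tX.
  rewrite /Xc dfE; last by case: dx.
  by rewrite eXx fX mul0r scale0r subr0.
Unshelve. all: by end_near. Qed.

Lemma qi_hypersurface_nabla nabla X Y : levi_civita q S nabla ->
  totally_geodesic_subset S P nabla ->
  tangent M p X -> tangent M p Y ->
  exists y v, [/\ tangent P (phi p) y & y = v *m A + h X Y *: w].
Proof.
move=> LC TG tX tY.
have dp := qi_gdom Q Mp.
have [vX eX] := qi_tangent_field Mp tX.
have [vY eY] := qi_tangent_field Mp tY.
set Xf := (fun u => X - _) in vX; set Yf := (fun u => Y - _) in vY.
have [WX [Xb [vSX vPX WXp nX]]] := qi_hypersurface_extension vX dp.
have [WY [Yb [vSY vPY WYp nY]]] := qi_hypersurface_extension vY dp.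
have oI : open (WX `&` WY) by apply: openI; [case: vSX|case: vSY].
have sX : WX `&` WY `<=` WX by exact: subIsetl.
have sY : WX `&` WY `<=` WY by exact: subIsetr.
have Ip : (WX `&` WY) (phi p) by [].
have tXf : tangent M p (Xf p) by rewrite /Xf eX.
have [_ [v e]] := qi_nabla Q LC Ip (vfield_sub oI sX vSX) (vfield_sub oI sY vSY) Mp tXf nX nY.
exists (nabla Xb Yb (phi p)), v; split; last by rewrite e /Xf /Yf eX eY.
apply: (TG _ _ _ (vfield_sub oI sX vSX) (vfield_sub oI sY vSY)
  (vfield_sub oI sX vPX) (vfield_sub oI sY vPY)) => //.
by apply: MP; exists p.
Qed.

(** [nu] is the gradient of [f] on the sphere. Were it null, the derivative of [f] along [nu] would
    be [<nu, nu> = 0], so [nu] would be tangent to [P] and orthogonal to its tangent space.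
    Non-degeneracy would give [nu = 0], contradicting transversality of [eta]. *)
Lemma qi_hypersurface_normal : Defs.nondegenerate q P ->
  exists nu, [/\ scal q nu (phi p) = 0, scal q nu nu != 0 &
    forall y, tangent P (phi p) y -> scal q nu y = 0].
Proof.
move=> ND; have Sp := qi_sphere Q Mp.
have Pp : P (phi p) by apply: MP; exists p.
have [nu0 nu0E] := scal_riesz q ('d f (phi p)).
pose nu := nu0 - scal q nu0 (phi p) *: phi p.
have nup : scal q nu (phi p) = 0.
  by rewrite /nu !scalE [scal q (phi p) (phi p)]Sp mulr1 subrr.
have nuE y : scal q (phi p) y = 0 -> scal q nu y = 'd f (phi p) y.
  by move=> py; rewrite /nu scalDl scalNl scalZl py mulr0 subr0 nu0E.
have nuT y : tangent P (phi p) y -> scal q nu y = 0.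
  by move=> /(tangent_P _ dom_p Pp) [/nuE ->].
exists nu; split => //; apply/negP => /eqP nn.
have pnu : scal q (phi p) nu = 0 by rewrite scalC.
have tnu : tangent P (phi p) nu by apply/tangent_P => //; rewrite -nuE.
have nu_0 : nu = 0 by apply: ND tnu _ => // y /nuT.
apply: feta; rewrite -nuE ?nu_0 ?scal0l //.
by apply/tangent_psphere.
Qed.

End Hypersurface.

(* A normal nu of P at phi p is orthogonal to the tangent space of M and, by
   total geodesy, to nabla_X Y; if h X Y <> 0 this forces nu to be orthogonal to
   the range of A and to w.  The second alternative is for the case (6) with
   m = 2, where h vanishes on the tangent space of M. *)
Lemma qi_full nabla : levi_civita q S nabla ->
  (forall nu, (forall v, scal q nu (v *m A) = 0) -> scal q nu w = 0 ->
     scal q nu nu = 0) ->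
  (exists p, M p /\
    ((exists X Y, [/\ h p X = 0, h p Y = 0 & h X Y != 0]) \/
     (forall nu, (forall v, h p v = 0 -> scal q nu (v *m A) = 0) ->
        scal q nu (phi p) = 0 -> scal q nu nu = 0))) ->
  full q M S phi nabla.
Proof.
move=> LC null [p [Mp alt]] P [PS HP] ND TG MP.
have Pp : P (phi p) by apply: MP; exists p.
have [W [f [oW Wp sf Pf [eta teta feta]]]] := HP _ Pp.
have [nu [nup nunu nuT]] :=
  qi_hypersurface_normal PS MP Mp oW Wp sf Pf teta feta ND.
have nuA v : h p v = 0 -> scal q nu (v *m A) = 0.
  move=> /(qi_tangent Q _ Mp) tv; apply: nuT; exact: qi_tangent_image.
case: alt => [[X [Y [hX hY hXY]]]|H]; last first.
  by move/eqP: nunu; apply; exact: H.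
have tX : tangent M p X by apply/(qi_tangent Q _ Mp).
have tY : tangent M p Y by apply/(qi_tangent Q _ Mp).
have [y [v [ty yE]]] :=
  qi_hypersurface_nabla PS MP Mp oW Wp sf Pf teta feta LC TG tX tY.
have Sp := qi_sphere Q Mp.
have py : scal q (phi p) y = 0.
  apply/tangent_psphere => //; case: ty => cv [c0 nP dc]; exists cv; split => //.
  by apply: filterS nP => t; exact: PS.
have hz := gunitE (qi_gdom Q Mp).
have [pc _] := (qi_mem Q p).1 Mp.
have phiE : phi p = p *m A + w by rewrite (qi_affine Q).
have lev := qi_level Q.
have orth := qi_orth Q.
set b := h X Y in hXY yE.
(* Tangency of [y] to the sphere, with [<w, w> = 1 - c]. *)
have e1 : h p v + b * (1 - c) = 0.
  move: py; rewrite yE scalDr (qi_scal_phi Q) scalZr phiE scalDl orth add0r.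
  by move=> <-; congr (_ + _ * _); move: lev; lra.
(* The functional on the left vanishes on the kernel of [h p], so it is a multiple of [h p];
   evaluation at [z p] gives the factor. *)
have nuv u : scal q nu (u *m A) = h p u * scal q nu (z p *m A).
  have /nuA : h p (u - h p u *: z p) = 0.
    by rewrite gramDr gramNr gramZr hz mulr1 subrr.
  rewrite mulmxBl -scalemxAl scalDr scalNr scalZr => /eqP.
  by rewrite subr_eq0 => /eqP.
have e2 := nuT _ ty; rewrite yE scalDr scalZr nuv in e2.
have e3 := nup; rewrite phiE scalDr nuv pc in e3.
set s := scal q nu (z p *m A) in nuv e2 e3.
(* [s] and [<nu, w>] solve the homogeneous system [c s + <nu, w> = 0], [h p v s + b <nu, w> = 0]. By
   [e1] its determinant [c b - h p v] is [b], which is nonzero. *)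
have s0 : s = 0.
  have : b * s = 0.
    have -> : b * s = b * (c * s + scal q nu w) - (h p v * s + b * scal q nu w) +
      (h p v + b * (1 - c)) * s by ring.
    by rewrite e1 e2 e3 mulr0 mul0r subr0 addr0.
  by move/eqP; rewrite mulf_eq0 (negPf hXY) /= => /eqP.
move/eqP: nunu; apply; apply: null => [u|]; first by rewrite nuv s0 mulr0.
by move: e3; rewrite s0 mulr0 add0r.
Qed.

(** * Radical of the induced metric *)

Section Radical.
Variables (rho : nat) (K : 'M[R]_(rho, n)).
Hypotheses (freeK : row_free K)
  (radK : forall v, (forall u, h v u = 0) <-> (v <= K)%MS).

Let radicalE p v : M p -> radical q M phi p v <->
  h p v = 0 /\ forall u, h p u = 0 -> h v u = 0.
Proof.
move=> Mp; rewrite /radical /= (qi_tangent Q _ Mp); split => -[hv H]; split => // u.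
  by move=> /(qi_tangent Q _ Mp) /H; rewrite /induced_metric !(qi_diff Q).
by move=> /(qi_tangent Q _ Mp) /H; rewrite /induced_metric !(qi_diff Q).
Qed.

(** Since [h p p = c] is nonzero, [p] complements the tangent space; a tangent vector, already
    orthogonal to [p], is radical exactly when it is in the radical of [h]. *)
Lemma qi_lightlike : c != 0 -> (0 < rho)%N -> lightlike q rho M phi.
Proof.
move=> c0 rho0; split => // p Mp; exists K => // v.
have [pc _] := (qi_mem Q p).1 Mp.
rewrite radicalE // -radK; split => [[hv H] u|H].
  have hu : h p (u - (h p u / c) *: p) = 0.
    by rewrite gramDr gramNr gramZr pc divfK // subrr.
  move: (H _ hu); rewrite gramDr gramNr gramZr [h v p]gramC hv mulr0 subr0.
  exact.
by split => [|u _]; rewrite ?[h p v]gramC H.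
Qed.

(** The position vector is now tangent and orthogonal to every tangent vector, yet outside the
    radical of [h], so it raises the rank by one. *)
Lemma qi_lightlike_cone : c = 0 -> lightlike q rho.+1 M phi.
Proof.
move=> c0; split => // p Mp.
have [pc _] := (qi_mem Q p).1 Mp.
have hz := gunitE (qi_gdom Q Mp).
have radK' b u : h (b *m K) u = 0 by exact: (radK _).2 (submxMl _ _) u.
have freeE : row_free (col_mx p K : 'M[R]_(1 + rho, n)).
  rewrite -kermx_eq0; apply/rowV0P => a /sub_kermxP.
  rewrite -[a]hsubmxK mul_row_col => e.
  have l0 : lsubmx a = 0.
    have : h (lsubmx a *m p + rsubmx a *m K) (z p) = 0 by rewrite e gram0l.
    rewrite gramDl radK' addr0 [lsubmx a]mx11_scalar mul_scalar_mx gramZl hz mulr1.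
    by move=> ->; rewrite raddf0.
  move: e; rewrite l0 mul0mx add0r => rK.
  by rewrite (row_free_inj freeK (etrans rK (esym (mul0mx _ _)))) row_mx0.
exists (col_mx p K : 'M[R]_(1 + rho, n)) => // v.
change (radical q M phi p v <-> (v <= (col_mx p K : 'M[R]_(1 + rho, n)))%MS).
rewrite -addsmxE radicalE //; split => [[hv H]|/sub_addsmxP [[a b] ->]] /=.
  (* Orthogonality of [v] to the tangent vector [u - h p u *: z p] says [h v u = h p u * h v (z p)]
     for all [u]. *)
  have : (v - h v (z p) *: p <= K)%MS.
    apply/radK => u; rewrite gramDl gramNl gramZl.
    have hu : h p (u - h p u *: z p) = 0.
      by rewrite gramDr gramNr gramZr hz mulr1 subrr.
    move: (H _ hu); rewrite gramDr gramNr gramZr => /eqP.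
    by rewrite subr_eq0 => /eqP ->; rewrite mulrC subrr.
  move=> /submxP [b bE]; apply/sub_addsmxP.
  exists ((h v (z p))%:M, b) => /=.
  by rewrite -bE mul_scalar_mx addrC subrK.
rewrite [a]mx11_scalar mul_scalar_mx.
split => [|u hu]; first by rewrite gramDr gramZr pc c0 mulr0 gramC radK' addr0.
by rewrite gramDl radK' gramZl hu mulr0 addr0.
Qed.

End Radical.

Lemma qi_full_umbilical_lightlike r d g :
  (1 + d = n)%N -> (forall u v, h u v = g u v) -> lightlike q r M phi ->
  (forall nu, (forall v, scal q nu (v *m A) = 0) -> scal q nu w = 0 ->
     scal q nu nu = 0) ->
  (exists p, M p /\
    ((exists X Y, [/\ h p X = 0, h p Y = 0 & h X Y != 0]) \/
     (forall nu, (forall v, h p v = 0 -> scal q nu (v *m A) = 0) ->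
        scal q nu (phi p) = 0 -> scal q nu nu = 0))) ->
  full_umbilical_lightlike r d q M g S phi.
Proof.
move=> dn hg LL null alt; split => //; first exact: (qi_isometric_immersion Q dn hg).
by move=> nabla LC; split; [exact: (qi_totally_umbilical Q LC)|exact: (qi_full LC null alt)].
Qed.

End FullLightlike.

(** * The seven immersions *)

Section Blocks.
Variable R : realType.

Lemma scal_row_mx n1 n2 p (a c : 'rV[R]_n1) (b d : 'rV[R]_n2) :
  scal p (row_mx a b) (row_mx c d) = scal p a c + scal (p - n1) b d.
Proof.
rewrite /scal big_split_ord /=; congr (_ + _); apply: eq_bigr => i _.
  by rewrite !row_mxEl.
by rewrite !row_mxEr -ltn_subRL.
Qed.

Lemma scal_rV1 p (a b : 'rV[R]_1) :
  scal p a b = (if (0 < p)%N then -1 else 1) * (a 0 0 * b 0 0).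
Proof. by rewrite /scal big_ord1. Qed.

Lemma scal_delta_delta n p (i j : 'I_n) :
  scal p (delta_mx 0 i : 'rV[R]_n) (delta_mx 0 j) =
    (if (j < p)%N then -1 else 1) * (j == i)%:R.
Proof. by rewrite scal_delta mxE eqxx. Qed.

(** The last axis is spacelike because [p < n]; the first one, distinct from it, supplies a non-null
    tangent vector for the fullness argument. *)
Lemma psphere_point n p r : (p < n)%N -> (2 <= n)%N ->
  exists x y : 'rV[R]_n,
    [/\ scal p x x = r ^+ 2, scal p x y = 0 & scal p y y != 0].
Proof.
move=> pn n2; have l1 : (n.-1 < n)%N by lia. have l0 : (0 < n)%N by lia.
exists (r *: delta_mx 0 (Ordinal l1)), (delta_mx 0 (Ordinal l0)).
have e1 : (n.-1 < p)%N = false by lia.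
have e2 : (Ordinal l0 == Ordinal l1) = false by rewrite -val_eqE /=; lia.
rewrite !scalE !scal_delta_delta !eqxx e2 /= e1 !mulr1 !mulr0 expr2; split => //.
by case: ifP; rewrite ?oppr_eq0 oner_eq0.
Qed.

Lemma phyperbolic_point n p r : (p < n)%N -> (2 <= n)%N ->
  exists x y : 'rV[R]_n,
    [/\ scal p.+1 x x = - r ^+ 2, scal p.+1 x y = 0 & scal p.+1 y y != 0].
Proof.
move=> pn n2; have l1 : (n.-1 < n)%N by lia. have l0 : (0 < n)%N by lia.
exists (r *: delta_mx 0 (Ordinal l0)), (delta_mx 0 (Ordinal l1)).
have e2 : (Ordinal l1 == Ordinal l0) = false by rewrite -val_eqE /=; lia.
rewrite !scalE !scal_delta_delta !eqxx e2 /= !mulr1 !mulr0; split => //.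
  by rewrite expr2; ring.
by case: ifP; rewrite ?oppr_eq0 oner_eq0.
Qed.

(** The sum of the first axis, which is timelike, and the last, which is spacelike; it is orthogonal
    to all axes in between. *)
Lemma lightcone_null_point n p : (p.+1 < n)%N ->
  exists x : 'rV[R]_n, [/\ x <> 0, scal p.+1 x x = 0 &
    forall i : 'I_n, (0 < i < n.-1)%N -> scal p.+1 x (delta_mx 0 i) = 0].
Proof.
move=> pn; have l1 : (n.-1 < n)%N by lia. have l0 : (0 < n)%N by lia.
exists (delta_mx 0 (Ordinal l0) + delta_mx 0 (Ordinal l1)).
have e1 : (n.-1 < p.+1)%N = false by lia.
have e2 : (Ordinal l0 == Ordinal l1) = false by rewrite -val_eqE /=; lia.
split.
- move=> /rowP /(_ (Ordinal l0)) /eqP; rewrite !mxE !eqxx e2 addr0.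
  by rewrite oner_eq0.
- rewrite !scalE !scal_delta_delta !eqxx [Ordinal l1 == _]eq_sym e2 /= e1.
  by rewrite !mulr1 !mulr0 addr0 add0r addNr.
- move=> i /andP[i0 i1]; rewrite !scalE !scal_delta_delta.
  have -> : (i == Ordinal l0) = false by rewrite -val_eqE /=; lia.
  have -> : (i == Ordinal l1) = false by rewrite -val_eqE /=; lia.
  by rewrite !mulr0 addr0.
Qed.

Lemma lightcone_point n p : (p.+1 < n)%N -> (3 <= n)%N ->
  exists x y : 'rV[R]_n,
    [/\ x <> 0, scal p.+1 x x = 0, scal p.+1 x y = 0 & scal p.+1 y y != 0].
Proof.
move=> pn n3; have [x [x0 xx xd]] := lightcone_null_point pn.
have l1 : (1 < n)%N by lia.
exists x, (delta_mx 0 (Ordinal l1)); split => //.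
  by apply: xd => /=; lia.
rewrite scal_delta_delta eqxx mulr1.
by case: ifP; rewrite ?oppr_eq0 oner_eq0.
Qed.

End Blocks.

(** * Products with the degenerate line *)

Section TimesLine.
Variables (R : realType) (m N q p : nat) (A : 'M[R]_(m + 1, N)) (w : 'rV[R]_N).
Variables (c : R) (phi : 'rV[R]_(m + 1) -> 'rV[R]_N).
Hypothesis freeA : forall u : 'rV[R]_(m + 1), u *m A = 0 -> u = 0.
Hypothesis gramA : forall u v, gram q A u v = scal p (lsubmx u) (lsubmx v).
Hypothesis orthA : forall u, scal q (u *m A) w = 0.
Hypothesis level : c + scal q w w = 1.
Hypothesis phiE : forall u, phi u = u *m A + w.
Hypothesis null : forall nu, (forall v, scal q nu (v *m A) = 0) ->
  scal q nu w = 0 -> scal q nu nu = 0.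

Let K : 'M[R]_(1, m + 1) := row_mx 0 1%:M.

Let radK v : (forall u, gram q A v u = 0) <-> (v <= K)%MS.
Proof.
split=> [H|/submxP [a ->] u].
  have l0 : lsubmx v = 0.
    apply: (@scal_nondegenerate _ _ p) => x.
    by have := H (row_mx x 0); rewrite gramA row_mxKl.
  apply/submxP; exists (rsubmx v).
  by rewrite mul_mx_row mulmx0 mulmx1 -l0 hsubmxK.
by rewrite gramA mul_mx_row mulmx0 row_mxKl scal0l.
Qed.

Let freeK : row_free K.
Proof.
rewrite -kermx_eq0; apply/rowV0P => a /sub_kermxP.
rewrite mul_mx_row mulmx0 mulmx1 => /(congr1 rsubmx).
by rewrite row_mxKr linear0.
Qed.

Let row_freeA : row_free A.
Proof. by rewrite -kermx_eq0; apply/rowV0P => a /sub_kermxP; exact: freeA. Qed.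

Let gramL u v : gram q A u v = scal_line p u v.
Proof. by rewrite gramA /scal_line mul0r addr0. Qed.

Lemma line_quadric_immersion X : c != 0 -> X = [set x | scal p x x = c] ->
  quadric_immersion q A w c (times_line X) phi.
Proof.
move=> c0 ->; split => //; last exact/funext.
move=> u; rewrite gramA /times_line /=; split => [H|[]//]; split => //.
by exists u; rewrite gramA H.
Qed.

Lemma line_nonzero X : c != 0 -> X = [set x | scal p x x = c] ->
  (exists x y : 'rV[R]_m, [/\ scal p x x = c, scal p x y = 0 & scal p y y != 0]) ->
  full_umbilical_lightlike 1 m q (times_line X) (scal_line p)
    (psphere N q (1 : R)) phi.
Proof.
move=> c0 XE [x [y [xx xy yy]]]; have Q := line_quadric_immersion c0 XE.
apply: (qi_full_umbilical_lightlike Q) => //; first by rewrite addnC.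
  exact: (qi_lightlike Q freeK radK).
exists (row_mx x 0); split; first by rewrite XE /times_line /= row_mxKl.
left; exists (row_mx y 0), (row_mx y 0).
by rewrite !gramA !row_mxKl xy; split.
Qed.

(** The radical of [gram q A] is the line factor, since [scal p] is non-degenerate; being outside it
    is the same as having a nonzero first component. *)
Lemma line_cone_quadric_immersion X : c = 0 ->
  X = [set x | x <> 0 /\ scal p x x = c] ->
  quadric_immersion q A w c (times_line X) phi.
Proof.
move=> c0 ->; split => //; last exact/funext.
move=> u; rewrite gramA /times_line /=; split => [[u0 H]|[H [z hz]]]; split => //.
  apply: contrapT => /forallNP hz; apply: u0.
  apply: (@scal_nondegenerate _ _ p) => x.
  have := hz (row_mx x 0); rewrite gramA row_mxKl => /negP.
  by rewrite negbK => /eqP.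
by move: hz; rewrite gramA => /[swap] ->; rewrite scal0l eqxx.
Qed.

Lemma line_cone X : c = 0 -> X = [set x | x <> 0 /\ scal p x x = c] ->
  (exists P, times_line X P /\
    ((exists x y, [/\ gram q A P x = 0, gram q A P y = 0 & gram q A x y != 0]) \/
     (forall nu, (forall v, gram q A P v = 0 -> scal q nu (v *m A) = 0) ->
        scal q nu (phi P) = 0 -> scal q nu nu = 0))) ->
  full_umbilical_lightlike 2 m q (times_line X) (scal_line p)
    (psphere N q (1 : R)) phi.
Proof.
move=> c0 XE alt; have Q := line_cone_quadric_immersion c0 XE.
apply: (qi_full_umbilical_lightlike Q) => //; first by rewrite addnC.
exact: (qi_lightlike_cone Q freeK radK).
Qed.

End TimesLine.

Section Embeddings.
Variables (R : realType) (m : nat).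
Local Notation I := (1%:M).

Lemma row_mx_ind n1 n2 (P : 'rV[R]_(n1 + n2) -> Prop) :
  (forall a b, P (row_mx a b)) -> forall u, P u.
Proof. by move=> H u; rewrite -[u]hsubmxK. Qed.

(** * The map of case (1) *)

Section Plain.
Variable s : nat.
Hypothesis sm : (s <= m)%N.
Local Notation q := s.+1.

Definition plain_mx : 'M[R]_(m + 1, 1 + m + 1) :=
  col_mx (row_mx (row_mx 0 I) 0) (row_mx (row_mx I 0) I).

Lemma plain_mulmx (x : 'rV[R]_m) t :
  row_mx x t *m plain_mx = row_mx (row_mx t x) t.
Proof.
by rewrite mul_row_col !mul_mx_row !mulmx0 !mulmx1 !add_row_mx !addr0 !add0r.
Qed.

Let scE (a d a' d' : 'rV[R]_1) (x x' : 'rV[R]_m) :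
  scal q (row_mx (row_mx a x) d) (row_mx (row_mx a' x') d') =
  - (a 0 0 * a' 0 0) + scal s x x' + d 0 0 * d' 0 0.
Proof.
rewrite !scal_row_mx !scal_rV1 /= subSS subn0.
have -> : (0 < s.+1 - (1 + m))%N = false by lia.
by rewrite mulN1r !mul1r.
Qed.

Lemma plain_free (u : 'rV[R]_(m + 1)) : u *m plain_mx = 0 -> u = 0.
Proof.
elim/row_mx_ind: u => x t; rewrite plain_mulmx => e.
have := congr1 rsubmx e; rewrite row_mxKr linear0 => ->.
have := congr1 (rsubmx \o lsubmx) e; rewrite /= row_mxKl row_mxKr !linear0.
by move=> ->; rewrite row_mx0.
Qed.

Lemma plain_gram u v : gram q plain_mx u v = scal s (lsubmx u) (lsubmx v).
Proof.
elim/row_mx_ind: u => x t; elim/row_mx_ind: v => y r.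
by rewrite /gram !plain_mulmx scE !row_mxKl; ring.
Qed.

Lemma plain_affine u :
  in_xt (fun x t => row_mx (row_mx t x) t) u = u *m plain_mx + 0.
Proof.
elim/row_mx_ind: u => x t; rewrite /in_xt row_mxKl row_mxKr plain_mulmx.
by rewrite addr0.
Qed.

(** Orthogonality to [(0, x, 0)] kills the middle block and orthogonality to [(1, 0, 1)] equates the
    outer entries: [nu] is a multiple of the null vector [(1, 0, 1)]. *)
Lemma plain_null nu : (forall v, scal q nu (v *m plain_mx) = 0) -> scal q nu nu = 0.
Proof.
elim/row_mx_ind: nu => nu d; elim/row_mx_ind: nu => a y H.
have Hx x t := H (row_mx x t).
have y0 : y = 0.
  apply: (@scal_nondegenerate _ _ s) => x.
  by have := Hx x 0; rewrite plain_mulmx scE !mxE; lra.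
have ad : d 0 0 = a 0 0.
  by have := Hx 0 (const_mx 1); rewrite plain_mulmx scE scal0r !mxE; lra.
by rewrite scE y0 scal0r ad; ring.
Qed.

End Plain.

(** * A spacelike constant coordinate: cases (2), (4) and (6) *)

Section SpacelikeConstant.
Variables (p : nat) (k : R).
Hypothesis pm : (p <= m)%N.
Local Notation q := p.+1.

Definition space_mx : 'M[R]_(m + 1, 1 + m + 1 + 1) :=
  col_mx (row_mx (row_mx (row_mx 0 I) 0) 0) (row_mx (row_mx (row_mx I 0) 0) I).

Definition space_vec : 'rV[R]_(1 + m + 1 + 1) :=
  row_mx (row_mx (row_mx 0 0) (cst1 k)) 0.

Lemma space_mulmx (x : 'rV[R]_m) t :
  row_mx x t *m space_mx = row_mx (row_mx (row_mx t x) 0) t.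
Proof.
by rewrite mul_row_col !mul_mx_row !mulmx0 !mulmx1 !add_row_mx !addr0 !add0r.
Qed.

Let scE (a b d a' b' d' : 'rV[R]_1) (x x' : 'rV[R]_m) :
  scal q (row_mx (row_mx (row_mx a x) b) d) (row_mx (row_mx (row_mx a' x') b') d') =
  - (a 0 0 * a' 0 0) + scal p x x' + b 0 0 * b' 0 0 + d 0 0 * d' 0 0.
Proof.
rewrite !scal_row_mx !scal_rV1 /= subSS subn0.
have -> : (0 < p.+1 - (1 + m))%N = false by lia.
have -> : (0 < p.+1 - (1 + m + 1))%N = false by lia.
by rewrite mulN1r !mul1r.
Qed.

Lemma space_free (u : 'rV[R]_(m + 1)) : u *m space_mx = 0 -> u = 0.
Proof.
elim/row_mx_ind: u => x t; rewrite space_mulmx => e.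
have := congr1 rsubmx e; rewrite row_mxKr linear0 => ->.
have := congr1 (rsubmx \o lsubmx \o lsubmx) e; rewrite /= !row_mxKl row_mxKr !linear0.
by move=> ->; rewrite row_mx0.
Qed.

Lemma space_gram u v : gram q space_mx u v = scal p (lsubmx u) (lsubmx v).
Proof.
elim/row_mx_ind: u => x t; elim/row_mx_ind: v => y r.
by rewrite /gram !space_mulmx scE !row_mxKl !mxE; ring.
Qed.

Lemma space_orth u : scal q (u *m space_mx) space_vec = 0.
Proof.
elim/row_mx_ind: u => x t.
by rewrite space_mulmx scE scal0r !mxE; ring.
Qed.

Lemma space_level c : c + k ^+ 2 = 1 -> c + scal q space_vec space_vec = 1.
Proof. by move=> <-; rewrite scE scal0r !mxE; ring. Qed.

Lemma space_affine u :
  in_xt (fun x t => row_mx (row_mx (row_mx t x) (cst1 k)) t) u =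
  u *m space_mx + space_vec.
Proof.
elim/row_mx_ind: u => x t; rewrite /in_xt row_mxKl row_mxKr space_mulmx.
by rewrite !add_row_mx !addr0 add0r.
Qed.

Lemma space_null nu : k != 0 -> (forall v, scal q nu (v *m space_mx) = 0) ->
  scal q nu space_vec = 0 -> scal q nu nu = 0.
Proof.
move=> k0; elim/row_mx_ind: nu => nu d; elim/row_mx_ind: nu => nu b.
elim/row_mx_ind: nu => a y H.
have Hx x t := H (row_mx x t); move=> kb.
rewrite /space_vec scE scal0r !mxE in kb.
have y0 : y = 0.
  apply: (@scal_nondegenerate _ _ p) => x.
  by have := Hx x 0; rewrite space_mulmx scE !mxE; lra.
have ad : d 0 0 = a 0 0.
  by have := Hx 0 (const_mx 1); rewrite space_mulmx scE scal0r !mxE; lra.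
have b0 : b 0 0 = 0.
  have : b 0 0 * k = 0 by move: kb; lra.
  by move/eqP; rewrite mulf_eq0 (negPf k0) orbF => /eqP.
by rewrite scE y0 scal0r b0 ad; ring.
Qed.

(** With orthogonality to tangent vectors only, the middle block [y] of [nu] is merely orthogonal to
    [x]. The assumption that such a [y] is null holds for a null line in a Lorentzian plane. *)
Lemma space_null_cone (x : 'rV[R]_m) nu : k != 0 ->
  (forall y, scal p y x = 0 -> scal p y y = 0) -> scal p x x = 0 ->
  (forall v, gram q space_mx (row_mx x 0) v = 0 -> scal q nu (v *m space_mx) = 0) ->
  scal q nu (row_mx x 0 *m space_mx + space_vec) = 0 -> scal q nu nu = 0.
Proof.
move=> k0 xnull xx.
elim/row_mx_ind: nu => nu d; elim/row_mx_ind: nu => nu b.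
elim/row_mx_ind: nu => a y H.
have yx : scal p y x = 0.
  have := H (row_mx x 0); rewrite space_gram !row_mxKl xx => /(_ erefl).
  by rewrite space_mulmx scE !mxE; lra.
have ad : d 0 0 = a 0 0.
  have := H (row_mx 0 (const_mx 1)); rewrite space_gram !row_mxKl scal0r => /(_ erefl).
  by rewrite space_mulmx scE scal0r !mxE; lra.
move=> kb; rewrite space_mulmx !add_row_mx scE !addr0 yx !mxE in kb.
have b0 : b 0 0 = 0.
  have : b 0 0 * k = 0 by move: kb; lra.
  by move/eqP; rewrite mulf_eq0 (negPf k0) orbF => /eqP.
by rewrite scE (xnull _ yx) b0 ad; ring.
Qed.

End SpacelikeConstant.

(** * A timelike constant coordinate: case (3) *)

Section TimelikeConstant.
Variables (p : nat) (k : R).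
Hypothesis pm : (p <= m)%N.
Local Notation q := p.+2.

Definition time_mx : 'M[R]_(m + 1, 1 + 1 + m + 1) :=
  col_mx (row_mx (row_mx (row_mx 0 0) I) 0) (row_mx (row_mx (row_mx I 0) 0) I).

Definition time_vec : 'rV[R]_(1 + 1 + m + 1) :=
  row_mx (row_mx (row_mx 0 (cst1 k)) 0) 0.

Lemma time_mulmx (x : 'rV[R]_m) t :
  row_mx x t *m time_mx = row_mx (row_mx (row_mx t 0) x) t.
Proof.
by rewrite mul_row_col !mul_mx_row !mulmx0 !mulmx1 !add_row_mx !addr0 !add0r.
Qed.

Let scE (a b d a' b' d' : 'rV[R]_1) (x x' : 'rV[R]_m) :
  scal q (row_mx (row_mx (row_mx a b) x) d) (row_mx (row_mx (row_mx a' b') x') d') =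
  - (a 0 0 * a' 0 0) - b 0 0 * b' 0 0 + scal p x x' + d 0 0 * d' 0 0.
Proof.
rewrite !scal_row_mx !scal_rV1 /=.
have -> : (p.+2 - (1 + 1) = p)%N by lia.
have -> : (0 < p.+2 - (1 + 1 + m))%N = false by lia.
by rewrite !mulN1r mul1r.
Qed.

Lemma time_free (u : 'rV[R]_(m + 1)) : u *m time_mx = 0 -> u = 0.
Proof.
elim/row_mx_ind: u => x t; rewrite time_mulmx => e.
have := congr1 rsubmx e; rewrite row_mxKr linear0 => ->.
have := congr1 (rsubmx \o lsubmx) e; rewrite /= row_mxKl row_mxKr !linear0.
by move=> ->; rewrite row_mx0.
Qed.

Lemma time_gram u v : gram q time_mx u v = scal p (lsubmx u) (lsubmx v).
Proof.
elim/row_mx_ind: u => x t; elim/row_mx_ind: v => y r.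
by rewrite /gram !time_mulmx scE !row_mxKl !mxE; ring.
Qed.

Lemma time_orth u : scal q (u *m time_mx) time_vec = 0.
Proof.
elim/row_mx_ind: u => x t.
by rewrite time_mulmx scE scal0r !mxE; ring.
Qed.

Lemma time_level c : c - k ^+ 2 = 1 -> c + scal q time_vec time_vec = 1.
Proof. by move=> <-; rewrite scE scal0r !mxE; ring. Qed.

Lemma time_affine u :
  in_xt (fun x t => row_mx (row_mx (row_mx t (cst1 k)) x) t) u =
  u *m time_mx + time_vec.
Proof.
elim/row_mx_ind: u => x t; rewrite /in_xt row_mxKl row_mxKr time_mulmx.
by rewrite !add_row_mx !addr0 add0r.
Qed.

Lemma time_null nu : k != 0 -> (forall v, scal q nu (v *m time_mx) = 0) ->
  scal q nu time_vec = 0 -> scal q nu nu = 0.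
Proof.
move=> k0; elim/row_mx_ind: nu => nu d; elim/row_mx_ind: nu => nu y.
elim/row_mx_ind: nu => a b H.
have Hx x t := H (row_mx x t); move=> kb.
rewrite /time_vec scE scal0r !mxE in kb.
have y0 : y = 0.
  apply: (@scal_nondegenerate _ _ p) => x.
  by have := Hx x 0; rewrite time_mulmx scE !mxE; lra.
have ad : d 0 0 = a 0 0.
  by have := Hx 0 (const_mx 1); rewrite time_mulmx scE scal0r !mxE; lra.
have b0 : b 0 0 = 0.
  have : b 0 0 * k = 0 by move: kb; lra.
  by move/eqP; rewrite mulf_eq0 (negPf k0) orbF => /eqP.
by rewrite scE y0 scal0r b0 ad; ring.
Qed.

End TimelikeConstant.

(** * A pair of constants forming a null vector: case (7) *)

Section NullConstant.
Variable p : nat.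
Hypothesis pm : (p <= m)%N.
Local Notation q := p.+2.

Definition null_mx : 'M[R]_(m + 1, 1 + 1 + m + 1 + 1) :=
  col_mx (row_mx (row_mx (row_mx (row_mx 0 0) I) 0) 0)
         (row_mx (row_mx (row_mx (row_mx I 0) 0) 0) I).

Definition null_vec : 'rV[R]_(1 + 1 + m + 1 + 1) :=
  row_mx (row_mx (row_mx (row_mx 0 (cst1 1)) 0) (cst1 1)) 0.

Lemma null_mulmx (x : 'rV[R]_m) t :
  row_mx x t *m null_mx = row_mx (row_mx (row_mx (row_mx t 0) x) 0) t.
Proof.
by rewrite mul_row_col !mul_mx_row !mulmx0 !mulmx1 !add_row_mx !addr0 !add0r.
Qed.

Let scE (a b e d a' b' e' d' : 'rV[R]_1) (x x' : 'rV[R]_m) :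
  scal q (row_mx (row_mx (row_mx (row_mx a b) x) e) d)
         (row_mx (row_mx (row_mx (row_mx a' b') x') e') d') =
  - (a 0 0 * a' 0 0) - b 0 0 * b' 0 0 + scal p x x' + e 0 0 * e' 0 0 +
  d 0 0 * d' 0 0.
Proof.
rewrite !scal_row_mx !scal_rV1 /=.
have -> : (p.+2 - (1 + 1) = p)%N by lia.
have -> : (0 < p.+2 - (1 + 1 + m))%N = false by lia.
have -> : (0 < p.+2 - (1 + 1 + m + 1))%N = false by lia.
by rewrite !mulN1r !mul1r.
Qed.

Lemma null_free (u : 'rV[R]_(m + 1)) : u *m null_mx = 0 -> u = 0.
Proof.
elim/row_mx_ind: u => x t; rewrite null_mulmx => e.
have := congr1 rsubmx e; rewrite row_mxKr linear0 => ->.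
have := congr1 (rsubmx \o lsubmx \o lsubmx) e; rewrite /= !row_mxKl row_mxKr !linear0.
by move=> ->; rewrite row_mx0.
Qed.

Lemma null_gram u v : gram q null_mx u v = scal p (lsubmx u) (lsubmx v).
Proof.
elim/row_mx_ind: u => x t; elim/row_mx_ind: v => y r.
by rewrite /gram !null_mulmx scE !row_mxKl !mxE; ring.
Qed.

Lemma null_orth u : scal q (u *m null_mx) null_vec = 0.
Proof.
elim/row_mx_ind: u => x t.
by rewrite null_mulmx scE scal0r !mxE; ring.
Qed.

Lemma null_level : 1 + scal q null_vec null_vec = 1.
Proof. by rewrite scE scal0r !mxE; ring. Qed.

Lemma null_affine u :
  in_xt (fun x t => row_mx (row_mx (row_mx (row_mx t (cst1 1)) x) (cst1 1)) t) u =
  u *m null_mx + null_vec.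
Proof.
elim/row_mx_ind: u => x t; rewrite /in_xt row_mxKl row_mxKr null_mulmx.
by rewrite !add_row_mx !addr0 !add0r.
Qed.

(** The two constant coordinates of [nu] are equal, just as the two outer ones are, and each pair
    has one timelike and one spacelike entry; both contributions cancel. *)
Lemma null_null nu : (forall v, scal q nu (v *m null_mx) = 0) ->
  scal q nu null_vec = 0 -> scal q nu nu = 0.
Proof.
elim/row_mx_ind: nu => nu d; elim/row_mx_ind: nu => nu e.
elim/row_mx_ind: nu => nu y; elim/row_mx_ind: nu => a b H.
have Hx x t := H (row_mx x t); move=> be.
rewrite /null_vec scE scal0r !mxE in be.
have y0 : y = 0.
  apply: (@scal_nondegenerate _ _ p) => x.
  by have := Hx x 0; rewrite null_mulmx scE !mxE; lra.
have ad : d 0 0 = a 0 0.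
  by have := Hx 0 (const_mx 1); rewrite null_mulmx scE scal0r !mxE; lra.
have eb : e 0 0 = b 0 0 by move: be; lra.
by rewrite scE y0 scal0r eb ad; ring.
Qed.

End NullConstant.

(** * The lightcone at height 1: case (5) *)

Section Cone.
Variable s : nat.
Hypothesis sm : (s < m)%N.
Local Notation q := s.+1.

Let A : 'M[R]_(m + 1, m + 1 + 1) := row_mx I 0.
Let w : 'rV[R]_(m + 1 + 1) := row_mx 0 (cst1 1).

Let scE (a a' : 'rV[R]_(m + 1)) (b b' : 'rV[R]_1) :
  scal q (row_mx a b) (row_mx a' b') = scal q a a' + b 0 0 * b' 0 0.
Proof.
rewrite scal_row_mx scal_rV1.
have -> : (0 < s.+1 - (m + 1))%N = false by lia.
by rewrite mul1r.
Qed.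

Let mulA (u : 'rV[R]_(m + 1)) : u *m A = row_mx u 0.
Proof. by rewrite mul_mx_row mulmx0 mulmx1. Qed.

Let gramA u v : gram q A u v = scal q u v.
Proof. by rewrite /gram !mulA scE !mxE mul0r addr0. Qed.

Lemma cone_quadric_immersion :
  quadric_immersion q A w 0 (lightcone R (m + 1) s) (fun x => row_mx x (cst1 1)).
Proof.
split.
- rewrite -kermx_eq0; apply/rowV0P => a /sub_kermxP; rewrite mulA.
  by move/(congr1 lsubmx); rewrite row_mxKl linear0.
- by move=> u; rewrite mulA scE scal0r !mxE; ring.
- by rewrite scE scal0r !mxE; ring.
- move=> u; rewrite gramA; split => [[u0 H]|[H [z hz]]]; split => //.
    apply: contrapT => /forallNP hz; apply: u0.
    apply: (@scal_nondegenerate _ _ q) => x.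
    by have /negP := hz x; rewrite gramA negbK => /eqP.
  by move: hz; rewrite gramA => /[swap] ->; rewrite scal0l eqxx.
- by apply/funext => u; rewrite mulA add_row_mx addr0 add0r.
Qed.

Lemma cone_full_umbilical_lightlike : (2 <= m)%N ->
  full_umbilical_lightlike 1 m q (lightcone R (m + 1) s) (scal q)
    (psphere (m + 1 + 1) q (1 : R)) (fun x => row_mx x (cst1 1)).
Proof.
move=> m2; apply: (qi_full_umbilical_lightlike cone_quadric_immersion).
- by rewrite addnC.
- exact: gramA.
(* The form is non-degenerate, so its radical has the empty basis, and the rank 1 comes from the
   position vector. *)
- apply: (qi_lightlike_cone cone_quadric_immersion (K := 0 : 'M[R]_(0, m + 1))) => //.
    by rewrite /row_free mxrank0.
  move=> v; split => [H|/submxP [b ->] u]; last by rewrite mulmx0 gram0l.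
  have -> : v = 0 by apply: (@scal_nondegenerate _ _ q) => u; rewrite -gramA.
  exact: sub0mx.
- elim/row_mx_ind => y d H.
  have Hx x : scal q y x = 0.
    by have := H x; rewrite mulA scE [X in _ + _ * X]mxE mulr0 addr0.
  rewrite (scal_nondegenerate Hx) !scE scal0r !mxE => d0.
  have -> : d 0 0 = 0 by move: d0; lra.
  by ring.
- have pn : (s.+1 < m + 1)%N by lia.
  have n3 : (3 <= m + 1)%N by lia.
  have [x [y [x0 xx xy yy]]] := lightcone_point R pn n3.
  exists x; split; first by split.
  by left; exists y, y; rewrite !gramA xy; split.
Qed.

End Cone.

(** In a Lorentzian plane the line of a null vector is its own orthogonal complement. The
    computation multiplies [<y, y>] by the nonzero square of the first coordinate of [x]. *)
Lemma plane_null (x y : 'rV[R]_2) : x <> 0 ->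
  scal 1 x x = 0 -> scal 1 y x = 0 -> scal 1 y y = 0.
Proof.
move=> x0; rewrite /scal !big_ord_recl !big_ord0 /=.
set i := lift _ _; set x0' := x 0 0; set x1 := x 0 i.
set y0 := y 0 0; set y1 := y 0 i => xx yx.
have x0n : x0' != 0.
  apply/eqP => e; apply: x0; apply/rowP => j; rewrite mxE.
  have x1e : x1 = 0.
    apply/eqP; rewrite -sqrf_eq0; apply/eqP; move: xx; rewrite e; lra.
  have [->|ji] : j = 0 \/ j = i; [|exact: e|by rewrite ji].
  by case: j => [[|[|//]]] ?; [left|right]; apply: val_inj.
have : x0' ^+ 2 * (-1 * (y0 * y0) + (1 * (y1 * y1) + 0)) = 0.
  have e1 : x0' ^+ 2 = x1 ^+ 2 by move: xx; rewrite !expr2; lra.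
  have e2 : y0 * x0' = y1 * x1 by move: yx; lra.
  have -> : x0' ^+ 2 * (-1 * (y0 * y0) + (1 * (y1 * y1) + 0)) =
    x0' ^+ 2 * y1 ^+ 2 - (y0 * x0') ^+ 2 by ring.
  by rewrite e2 e1; ring.
by move/eqP; rewrite mulf_eq0 sqrf_eq0 (negPf x0n) => /eqP.
Qed.

End Embeddings.

Theorem proposition10 (R : realType) (m s : nat) (hm : (2 <= m)%N) :
  (* (1) *)
  ((s <= m - 1)%N ->
    let M := times_line (psphere m s (1 : R)) in
    let S := psphere (1 + m + 1)%N s.+1 (1 : R) in
    let phi := in_xt (fun x t => row_mx (row_mx t x) t) in
    full_umbilical_lightlike 1 m s.+1 M (scal_line s) S phi /\
    (forall nabla, levi_civita s.+1 S nabla ->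
       totally_geodesic M S phi nabla)) /\
  (* (2) *)
  ((s <= m - 1)%N -> forall r : R, 0 < r -> r < 1 ->
    full_umbilical_lightlike 1 m s.+1
      (times_line (psphere m s (r ^+ 2))) (scal_line s)
      (psphere (1 + m + 1 + 1)%N s.+1 (1 : R))
      (in_xt (fun x t =>
         row_mx (row_mx (row_mx t x) (cst1 (Num.sqrt (1 - r ^+ 2)))) t))) /\
  (* (3) *)
  ((s <= m - 1)%N -> forall r : R, 1 < r ->
    full_umbilical_lightlike 1 m s.+2
      (times_line (psphere m s (r ^+ 2))) (scal_line s)
      (psphere (1 + 1 + m + 1)%N s.+2 (1 : R))
      (in_xt (fun x t =>
         row_mx (row_mx (row_mx t (cst1 (Num.sqrt (r ^+ 2 - 1)))) x) t))) /\
  (* (4) *)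
  ((s <= m - 1)%N -> forall r : R, 0 < r ->
    full_umbilical_lightlike 1 m s.+2
      (times_line (phyperbolic m s (- r ^+ 2))) (scal_line s.+1)
      (psphere (1 + m + 1 + 1)%N s.+2 (1 : R))
      (in_xt (fun x t =>
         row_mx (row_mx (row_mx t x) (cst1 (Num.sqrt (1 + r ^+ 2)))) t))) /\
  (* (5) *)
  ((s <= m - 1)%N ->
    full_umbilical_lightlike 1 m s.+1
      (lightcone R (m + 1)%N s) (scal s.+1)
      (psphere (m + 1 + 1)%N s.+1 (1 : R))
      (fun x => row_mx x (cst1 1))) /\
  (* (6) *)
  ((s <= m - 2)%N ->
    full_umbilical_lightlike 2 m s.+2
      (times_line (lightcone R m s)) (scal_line s.+1)
      (psphere (1 + m + 1 + 1)%N s.+2 (1 : R))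
      (in_xt (fun x t => row_mx (row_mx (row_mx t x) (cst1 1)) t))) /\
  (* (7) *)
  ((s <= m - 1)%N ->
    full_umbilical_lightlike 1 m s.+2
      (times_line (psphere m s (1 : R))) (scal_line s)
      (psphere (1 + 1 + m + 1 + 1)%N s.+2 (1 : R))
      (in_xt (fun x t =>
         row_mx (row_mx (row_mx (row_mx t (cst1 1)) x) (cst1 1)) t))).
Proof.
split.
  move=> sm M S phi; have sm' : (s <= m)%N by lia.
  have sm1 : (s < m)%N by lia.
  have Q : quadric_immersion s.+1 (plain_mx R m) 0 1 M phi.
    apply: (line_quadric_immersion (@plain_free R m) (plain_gram sm')) => //.
    - by move=> u; rewrite scal0r.
    - by rewrite scal0r addr0.
    - exact: plain_affine.
  split; last by move=> nabla LC; exact: (qi_totally_geodesic Q erefl LC).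
  apply: (line_nonzero (@plain_free R m) (plain_gram sm') _ _ (@plain_affine R m)) => //.
  - by move=> u; rewrite scal0r.
  - by rewrite scal0r addr0.
  - by move=> nu H _; exact: (plain_null sm' H).
  - exact: oner_neq0.
  - by have := psphere_point (1 : R) sm1 hm; rewrite expr1n.
split.
  move=> sm r r0 r1; have sm' : (s <= m)%N by lia.
  have sm1 : (s < m)%N by lia.
  have k2 : 0 < 1 - r ^+ 2 by rewrite subr_gt0 expr_lt1 // ltW.
  have k0 : Num.sqrt (1 - r ^+ 2) != 0 by rewrite gt_eqF // sqrtr_gt0.
  apply: (line_nonzero (@space_free R m) (space_gram sm') (space_orth _ sm')
    (space_level sm' _) (@space_affine R m _) (fun nu => space_null sm' k0)) => //.
  - by rewrite sqr_sqrtr ?ltW // addrC subrK.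
  - by rewrite expf_neq0 // gt_eqF.
  - exact: psphere_point.
split.
  move=> sm r r1; have sm' : (s <= m)%N by lia.
  have sm1 : (s < m)%N by lia.
  have r0 : 0 < r by exact: lt_trans r1.
  have k2 : 0 < r ^+ 2 - 1 by rewrite subr_gt0 exprn_egt1.
  have k0 : Num.sqrt (r ^+ 2 - 1) != 0 by rewrite gt_eqF // sqrtr_gt0.
  apply: (line_nonzero (@time_free R m) (time_gram sm') (time_orth _ sm')
    (time_level sm' _) (@time_affine R m _) (fun nu => time_null sm' k0)) => //.
  - by rewrite sqr_sqrtr ?ltW // opprB addrC subrK.
  - by rewrite expf_neq0 // gt_eqF.
  - exact: psphere_point.
split.
  move=> sm r r0; have sm' : (s.+1 <= m)%N by lia.
  have k2 : 0 < 1 + r ^+ 2 by rewrite ltr_wpDr // sqr_ge0.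
  have k0 : Num.sqrt (1 + r ^+ 2) != 0 by rewrite gt_eqF // sqrtr_gt0.
  apply: (line_nonzero (@space_free R m) (space_gram sm') (space_orth _ sm')
    (space_level sm' _) (@space_affine R m _) (fun nu => space_null sm' k0)) => //.
  - by rewrite sqr_sqrtr ?ltW // addrC addrK.
  - by rewrite oppr_eq0 expf_neq0 // gt_eqF.
  - exact: phyperbolic_point.
split.
  by move=> sm; apply: cone_full_umbilical_lightlike => //; lia.
split.
  move=> sm; have sm' : (s.+1 <= m)%N by lia.
  have sm1 : (s.+1 < m)%N by lia.
  have k0 : (1 : R) != 0 by exact: oner_neq0.
  apply: (line_cone (@space_free R m) (space_gram sm') (space_orth _ sm')
    (space_level sm' _) (@space_affine R m _) (fun nu => space_null sm' k0) _ erefl) => //.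
    by rewrite expr1n add0r.
  (* From dimension 3 on, a middle axis is a non-null tangent vector of the cone. For [m = 2] the
     bound on [s] forces [s = 0]; the tangent space of the cone is then the null line of [x], and
     [plane_null] takes over. *)
  have [m3|m2] := leqP 3 m.
    have [x [y [x0 xx xy yy]]] := lightcone_point R sm1 m3.
    exists (row_mx x 0); split; first by rewrite /times_line /= row_mxKl.
    left; exists (row_mx y 0), (row_mx y 0).
    by rewrite !(space_gram sm') !row_mxKl xy.
  have em : m = 2 by lia.
  have es : s = 0 by lia.
  subst m s; have [x [x0 xx _]] := lightcone_null_point R sm1.
  exists (row_mx x 0); split; first by rewrite /times_line /= row_mxKl.
  right => nu H; rewrite space_affine; apply: (space_null_cone sm' k0 _ xx H).
  by move=> y yx; exact: (plane_null x0 xx yx).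
move=> sm; have sm' : (s <= m)%N by lia.
have sm1 : (s < m)%N by lia.
apply: (line_nonzero (@null_free R m) (null_gram sm') (@null_orth R m _ sm')
  (@null_level R m _ sm') (@null_affine R m) (fun nu => @null_null R m _ sm' nu)
  (oner_neq0 R) erefl).
by have := psphere_point (1 : R) sm1 hm; rewrite expr1n.
Qed.
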